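(* Suppose the following hold. (1) The sets $\mathbb{U}$, $\mathbb{W}$, $\mathbb{Z}$, $\mathbb{X}_f$ are closed, convex, and contain the origin; $\mathbb{U}$ and $\mathbb{W}$ are bounded; and $\mathbb{W}$ contains the origin in its interior. (2) $Q,R,P\succeq 0$. (3) There exists $K_f\in\mathbb{R}^{m\times n}$ such that $P-Q-K_f'RK_f\succeq (A+BK_f)'P(A+BK_f)$; moreover $\mathbb{X}_f$ contains the origin in its interior, and $(x,K_fx)\in\mathbb{Z}$ and $(A+BK_f)x+Gw\in\mathbb{X}_f$ for all $x\in\mathbb{X}_f$ and $w\in\mathbb{W}$. (4) $Q\succ 0$, and either $\mathcal{X}$ is bounded or $\mathbb{X}_f=\mathbb{R}^n$. Then there exist $\lambda\in(0,1)$ and $c,\gamma>0$ such that $$\mathbb{E}_{\mathbb{P}}\left[\ell(x(k),u(k))\right]\le\lambda^k c|x|^2+\gamma\left(\max_{\Sigma\in\mathbb{B}_d}\mathrm{tr}(G'PG\Sigma)\right),$$ in which $x(k)=\phi_d(k;x,\mathbf{w}_\infty)$ and $u(k)=\kappa_d(x(k))$, for all $k\ge 0$, $x\in\mathcal{X}$, $d\in\mathcal{D}$, and $\mathbb{P}\in\mathcal{P}_d^\infty$.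
   Context: System: $x^+=Ax+Bu+Gw$ with $A\in\mathbb{R}^{n\times n}$, $B\in\mathbb{R}^{n\times m}$, $G\in\mathbb{R}^{n\times q}$, input set $\mathbb{U}\subseteq\mathbb{R}^m$, disturbance set $\mathbb{W}\subseteq\mathbb{R}^q$, state-input constraint set $\mathbb{Z}\subseteq\mathbb{R}^n\times\mathbb{U}$, terminal set $\mathbb{X}_f\subseteq\mathbb{R}^n$, horizon $N\ge 1$. A prime denotes transpose; positive (semi)definite matrices are symmetric. Policies: $\Theta$ is the set of pairs $\theta=(\mathbf{M},\mathbf{v})$ with $\mathbf{v}=(v(0),\dots,v(N-1))\in\mathbb{R}^{Nm}$ and $\mathbf{M}\in\mathbb{R}^{Nm\times Nq}$ having blocks $M(i,j)\in\mathbb{R}^{m\times q}$ ($0\le i,j\le N-1$) with $M(i,j)=0$ for $j\ge i$. Given $x\in\mathbb{R}^n$, $\theta\in\Theta$, $\mathbf{w}=(w(0),\dots,w(N-1))$, put $u(i)=v(i)+\sum_{j=0}^{i-1}M(i,j)w(j)$, $x(0)=x$, $x(i+1)=Ax(i)+Bu(i)+Gw(i)$ (open-loop trajectories). $\Pi(x)$ is the set of $\theta\in\Theta$ such that for all $\mathbf{w}\in\mathbb{W}^N$: $(x(k),u(k))\in\mathbb{Z}$ for $k=0,\dots,N-1$ and $x(N)\in\mathbb{X}_f$. Feasible set: $\mathcal{X}=\{x\in\mathbb{R}^n:\Pi(x)\ne\emptyset\}$. Cost: $\ell(x,u)=x'Qx+u'Ru$, $V_f(x)=x'Px$, $J(x,\theta,\mathbf{w})=\sum_{k=0}^{N-1}\ell(x(k),u(k))+V_f(x(N))$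 along the open-loop trajectory. Ambiguity: $\mathcal{M}(S)$ is the set of probability distributions with zero mean for which the random variable lies in $S$ with probability one. For $d=(\varepsilon,\widehat\Sigma)$ with $\varepsilon\ge 0$, $\widehat\Sigma\succeq 0$ in $\mathbb{R}^{q\times q}$, let $\mathbb{B}_d=\{\Sigma\succeq 0:\mathrm{tr}(\widehat\Sigma+\Sigma-2(\widehat\Sigma^{1/2}\Sigma\widehat\Sigma^{1/2})^{1/2})\le\varepsilon^2\}$ and $\mathcal{P}_d=\{\mathbb{P}\in\mathcal{M}(\mathbb{W}):\mathbb{E}_{\mathbb{P}}[ww']\in\mathbb{B}_d\}$. $\mathcal{D}$ is the set of all such $d$ for which every $\Sigma\in\mathbb{B}_d$ equals $\mathbb{E}_{\mathbb{P}}[ww']$ for some $\mathbb{P}\in\mathcal{M}(\mathbb{W})$. $\mathcal{P}_d^N$ (resp. $\mathcal{P}_d^\infty$) is the set of distributions of $(w(0),\dots,w(N-1))$ (resp. of $\mathbf{w}_\infty=(w(0),w(1),\dots)$) such that the $w(k)$ are independent and each $w(k)$ has distribution in $\mathcal{P}_d$. Controller: $V_d(x,\theta)=\max_{\mathbb{P}\in\mathcal{P}_d^N}\mathbb{E}_{\mathbb{P}}[J(x,\theta,\mathbf{w})]$, $V_d^0(x)=\min_{\theta\in\Pi(x)}V_d(x,\theta)$, and $\theta_d^0(x)$ is the set of minimizers. For each $d\in\mathcal{D}$, $\kappa_d:\mathcal{X}\to\mathbb{U}$ is a single-valued Borel measurable selection with $\kappa_d(x)\in\{v^0(0):(\mathbf{M}^0,\mathbf{v}^0)\in\theta_d^0(x)\}$.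 $\phi_d(k;x,\mathbf{w}_\infty)$ is the state at time $k$ of the closed-loop system $x^+=Ax+B\kappa_d(x)+Gw$ started at $x$ with disturbance sequence $\mathbf{w}_\infty\in\mathbb{W}^\infty$ (under the hypotheses $\mathcal{X}$ is invariant for this system, so this is well defined for $x\in\mathcal{X}$). *)

(* Defs.v *)
From HB Require Import structures.
From mathcomp Require Import all_boot all_order all_algebra.
From mathcomp Require Import finmap.
From mathcomp Require Import all_classical all_reals all_analysis.

Set Implicit Arguments.
Unset Strict Implicit.
Unset Printing Implicit Defensive.

Import Order.TTheory GRing.Theory Num.Theory.
Import numFieldNormedType.Exports.

Local Open Scope classical_set_scope.
Local Open Scope ring_scope.

(** Quadratic forms and semidefinite matrices *)

Definition quad (R : realType) (k : nat) (M : 'M[R]_k) (x : 'cV[R]_k) : R :=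
  (x^T *m M *m x) 0 0.

(* The norm that the library puts on matrices is the sup norm, hence this
   explicit Euclidean one. *)
Definition sqnorm (R : realType) (k : nat) (x : 'cV[R]_k) : R :=
  \sum_(i < k) x i 0 ^+ 2.

Definition psd (R : realType) (k : nat) (M : 'M[R]_k) : Prop :=
  M^T = M /\ forall x : 'cV[R]_k, 0 <= quad M x.

Definition posdef (R : realType) (k : nat) (M : 'M[R]_k) : Prop :=
  M^T = M /\ forall x : 'cV[R]_k, x != 0 -> 0 < quad M x.

Definition loewner_le (R : realType) (k : nat) (M1 M2 : 'M[R]_k) : Prop :=
  psd (M2 - M1).

(* A positive semidefinite matrix has exactly one positive semidefinite square
   root; the default value 0 is only reached when M is not semidefinite. *)
Definition psd_sqrt (R : realType) (k : nat) (M : 'M[R]_k) : 'M[R]_k :=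
  xget 0 [set S : 'M[R]_k | psd S /\ S *m S = M].

(** Borel and path spaces *)

Definition borel (T : ptopologicalType) := g_sigma_algebraType (@open T).

Definition cylinders (I : Type) (dT : measure_display) (T : measurableType dT) :
    set (set (I -> T)) :=
  \bigcup_(i in [set: I])
    preimage_set_system [set: I -> T] (fun w : I -> T => w i) measurable.

(* Families (w i)_i, with the sigma-algebra generated by the coordinates *)
Definition path_space (I : Type) (dT : measure_display)
    (T : measurableType dT) :=
  g_sigma_algebraType (@cylinders I dT T).

Definition coord (I : Type) (dT : measure_display) (T : measurableType dT)
    (i : I) (w : path_space I T) : T := w i.

Lemma measurable_coord (I : Type) (dT : measure_display)
    (T : measurableType dT) (i : I) :
  measurable_fun [set: path_space I T] (@coord I dT T i).
Proof.
move=> _ B mB; apply: sub_sigma_algebra; exists i => //.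
by exists B.
Qed.

HB.instance Definition _ (I : Type) (dT : measure_display)
    (T : measurableType dT) (i : I) :=
  isMeasurableFun.Build _ _ _ _ (@coord I dT T i) (@measurable_coord I dT T i).

Definition independent_coords (R : realType) (I : choiceType)
    (dT : measure_display) (T : measurableType dT)
    (Pr : probability (path_space I T) R) : Prop :=
  forall (J : {fset I}) (E : I -> set T), (forall i, measurable (E i)) ->
    Pr (\bigcap_(i in [set` J]) (@coord I dT T i @^-1` E i)) =
    (\prod_(i <- J) Pr (@coord I dT T i @^-1` E i))%E.

(** Disturbance distributions *)

(* An expectation equal to 0 is meant in \bar R and so entails integrability:
   the library sets +oo - oo = -oo. *)
Definition zero_mean_on (R : realType) (q : nat) (S : set 'cV[R]_q) :
    set (probability (borel 'cV[R]_q) R) :=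
  [set mu | (forall i : 'I_q,
              'E_mu[(fun w : borel 'cV[R]_q => (w : 'cV[R]_q) i ord0)]%E = 0%E)
            /\ {ae mu, forall w, S w}].

Definition second_moment (R : realType) (q : nat)
    (mu : probability (borel 'cV[R]_q) R) : 'M[R]_q :=
  \matrix_(i < q, j < q)
    fine 'E_mu[(fun w : borel 'cV[R]_q =>
                  (w : 'cV[R]_q) i 0 * (w : 'cV[R]_q) j 0)%R]%E.

(* The parameter d is the pair (radius, nominal covariance). *)
Definition cov_ball (R : realType) (q : nat) (d : R * 'M[R]_q) :
    set 'M[R]_q :=
  let h := psd_sqrt d.2 in
  [set S | psd S /\ \tr (d.2 + S - 2 *: psd_sqrt (h *m S *m h)) <= d.1 ^+ 2].

Definition ambiguity (R : realType) (q : nat) (W : set 'cV[R]_q)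
    (d : R * 'M[R]_q) : set (probability (borel 'cV[R]_q) R) :=
  [set mu | zero_mean_on W mu /\ cov_ball d (second_moment mu)].

Definition admissible (R : realType) (q : nat) (W : set 'cV[R]_q) :
    set (R * 'M[R]_q) :=
  [set d | [/\ 0 <= d.1, psd d.2 &
    forall S, cov_ball d S ->
      exists2 mu, zero_mean_on W mu & second_moment mu = S]].

(* Used with I = 'I_N for finite disturbance sequences and with I = nat for
   infinite ones. *)
Definition seq_ambiguity (R : realType) (q : nat) (I : choiceType)
    (W : set 'cV[R]_q) (d : R * 'M[R]_q) :
    set (probability (path_space I (borel 'cV[R]_q)) R) :=
  [set Pr | independent_coords Pr /\
    forall i : I,
      ambiguity W d (distribution Pr (@coord I _ (borel 'cV[R]_q) i))].

Arguments seq_ambiguity {R q} I W d.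

(** The control problem *)

Record mpc (R : realType) (n m q : nat) := MPC {
  mpcA : 'M[R]_n;
  mpcB : 'M[R]_(n, m);
  mpcG : 'M[R]_(n, q);
  mpcU : set 'cV[R]_m;
  mpcW : set 'cV[R]_q;
  mpcZ : set ('cV[R]_n * 'cV[R]_m);
  mpcXf : set 'cV[R]_n;
  mpcN : nat;
  mpcQ : 'M[R]_n;
  mpcR : 'M[R]_m;
  mpcP : 'M[R]_n
}.

Definition ext0 (V : nmodType) (N : nat) (f : 'I_N -> V) (k : nat) : V :=
  if insub k is Some i then f i else 0.

(* The blocks M(i,j) and v(i) *)
Definition policy (R : realType) (m q N : nat) : Type :=
  ('I_N -> 'I_N -> 'M[R]_(m, q)) * ('I_N -> 'cV[R]_m).

Definition causal (R : realType) (m q N : nat) : set (policy R m q N) :=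
  [set th | forall i j : 'I_N, (i <= j)%N -> th.1 i j = 0].

Definition ol_input (R : realType) (m q N : nat) (th : policy R m q N)
    (w : 'I_N -> 'cV[R]_q) (i : 'I_N) : 'cV[R]_m :=
  th.2 i + \sum_(j < N | (j < i)%N) th.1 i j *m w j.

Fixpoint trajectory (R : realType) (n m q : nat) (s : mpc R n m q)
    (x : 'cV[R]_n) (u : nat -> 'cV[R]_m) (w : nat -> 'cV[R]_q) (k : nat) :
    'cV[R]_n :=
  if k is k'.+1 then
    mpcA s *m trajectory s x u w k' + mpcB s *m u k' + mpcG s *m w k'
  else x.

Definition ol_state (R : realType) (n m q : nat) (s : mpc R n m q)
    (x : 'cV[R]_n) (th : policy R m q (mpcN s))
    (w : 'I_(mpcN s) -> 'cV[R]_q) (k : nat) : 'cV[R]_n :=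
  trajectory s x (ext0 (ol_input th w)) (ext0 w) k.
Arguments ol_state {R n m q} s x th w k.

Definition feasible_policies (R : realType) (n m q : nat) (s : mpc R n m q)
    (x : 'cV[R]_n) : set (policy R m q (mpcN s)) :=
  [set th | causal th /\
    forall w : 'I_(mpcN s) -> 'cV[R]_q, (forall i, mpcW s (w i)) ->
      (forall k : 'I_(mpcN s), mpcZ s (ol_state s x th w k, ol_input th w k)) /\
      mpcXf s (ol_state s x th w (mpcN s))].
Arguments feasible_policies {R n m q} s x.

Definition feasible_set (R : realType) (n m q : nat) (s : mpc R n m q) :
    set 'cV[R]_n :=
  [set x | feasible_policies s x !=set0].

Definition stage_cost (R : realType) (n m q : nat) (s : mpc R n m q)
    (x : 'cV[R]_n) (u : 'cV[R]_m) : R :=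
  quad (mpcQ s) x + quad (mpcR s) u.

Definition total_cost (R : realType) (n m q : nat) (s : mpc R n m q)
    (x : 'cV[R]_n) (th : policy R m q (mpcN s))
    (w : 'I_(mpcN s) -> 'cV[R]_q) : R :=
  \sum_(k < mpcN s) stage_cost s (ol_state s x th w k) (ol_input th w k)
  + quad (mpcP s) (ol_state s x th w (mpcN s)).
Arguments total_cost {R n m q} s x th w.

Definition worst_cost (R : realType) (n m q : nat) (s : mpc R n m q)
    (d : R * 'M[R]_q) (x : 'cV[R]_n) (th : policy R m q (mpcN s)) : \bar R :=
  ereal_sup [set 'E_Pr[(fun w : path_space 'I_(mpcN s) (borel 'cV[R]_q) =>
                       total_cost s x th w)]%E
            | Pr in seq_ambiguity 'I_(mpcN s) (mpcW s) d].
Arguments worst_cost {R n m q} s d x th.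

Definition value (R : realType) (n m q : nat) (s : mpc R n m q)
    (d : R * 'M[R]_q) (x : 'cV[R]_n) : \bar R :=
  ereal_inf [set worst_cost s d x th | th in feasible_policies s x].

Definition optimal_policies (R : realType) (n m q : nat) (s : mpc R n m q)
    (d : R * 'M[R]_q) (x : 'cV[R]_n) : set (policy R m q (mpcN s)) :=
  [set th | feasible_policies s x th /\ worst_cost s d x th = value s d x].
Arguments optimal_policies {R n m q} s d x.

(* Only the values of kap on the feasible set matter. *)
Definition control_law (R : realType) (n m q : nat) (s : mpc R n m q)
    (d : R * 'M[R]_q) (kap : 'cV[R]_n -> 'cV[R]_m) : Prop :=
  [/\ forall x, feasible_set s x -> mpcU s (kap x),
      forall x, feasible_set s x ->
        exists2 th, optimal_policies s d x th & kap x = ext0 th.2 0 &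
      measurable_fun (feasible_set s : set (borel 'cV[R]_n))
        (kap : borel 'cV[R]_n -> borel 'cV[R]_m)].

Fixpoint cl_state (R : realType) (n m q : nat) (s : mpc R n m q)
    (kap : 'cV[R]_n -> 'cV[R]_m) (x : 'cV[R]_n) (w : nat -> 'cV[R]_q)
    (k : nat) : 'cV[R]_n :=
  if k is k'.+1 then
    let y := cl_state s kap x w k' in
    mpcA s *m y + mpcB s *m kap y + mpcG s *m w k'
  else x.

(* E[l(x(k), u(k))] in closed loop. The integral runs over the sequences with
   values in W, a set of full measure for every law in seq_ambiguity when W is
   closed: the closed loop is only well defined there. *)
Definition expected_stage_cost (R : realType) (n m q : nat) (s : mpc R n m q)
    (kap : 'cV[R]_n -> 'cV[R]_m) (x : 'cV[R]_n) (k : nat)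
    (Pr : probability (path_space nat (borel 'cV[R]_q)) R) : \bar R :=
  (\int[Pr]_(w in [set w | forall i : nat, mpcW s (w i)])
     (stage_cost s (cl_state s kap x w k) (kap (cl_state s kap x w k)))%:E)%E.

(* Main.v *)
Require Import Defs.
From HB Require Import structures.
From mathcomp Require Import all_boot all_order all_algebra.
From mathcomp Require Import finmap.
From mathcomp Require Import all_classical all_reals all_analysis.
From mathcomp Require Import measurable_realfun.
From mathcomp Require Import ring lra.

(** The optimal cost [V] of the finite-horizon problem is a stochastic Lyapunov
    function of the closed loop. Write [l] for the stage cost and [sigma] for the
    largest value of [tr (G' P G S)] over the covariance ball. Then
    - [c1 |x|^2 <= l (x, kappa x) <= V x], because [Q] is positive definite
      ([posdef_coercive], [stage_le_value]);
    - [V x <= c |x|^2 + N sigma]: in the terminal set the feedback [Kf] is a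
      feasible policy whose cost telescopes, and outside of it [|x|] is bounded
      below while all feasible costs are bounded ([value_upper]);
    - from [x], the expectation of [V] at the successor state is at most
      [V x - l (x, kappa x) + sigma] ([value_descent]).
    Together they give [E V (x (k + 1)) <= lambda E V (x k) + C sigma] with
    [lambda = 1 - c1 / c2 < 1], where [c2 > c1] is at least [c], and the theorem
    follows by iteration.

    The decrease compares the optimal policy at [x] with its shift by one step,
    completed by [Kf], at the successor state. The successor depends on the
    disturbance [t] that occurs, and the worst-case law at the successor could
    depend on it too. It does not. As the disturbances have zero mean, the expected
    cost of a policy is its cost without disturbances plus a term that depends only
    on its gains and on the law ([Rintegral_total_cost]), and the gains of the
    shifted policy are the same for all [t]. So the supremum over laws commutes
    with the integral over [t], and what remains is the cost of the optimal
    policy at [x] under the law of [t] followed by the later disturbances, which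
    is admissible ([seq_ambiguity_cons], [shift_expected_descent]).

    Independence is used through one identity: replacing a coordinate by an
    independent copy preserves the law ([integral_resample]). It kills the cross
    terms between a state and the next disturbance ([Rintegral_path_step_le]) and
    drives the iteration ([closed_loop_lower_integral]), which works with
    measurable functions below [V (x k)]. *)

Set Implicit Arguments.
Unset Strict Implicit.
Unset Printing Implicit Defensive.

Import Order.TTheory GRing.Theory Num.Theory.
Import numFieldNormedType.Exports.

Local Open Scope classical_set_scope.
Local Open Scope ring_scope.

(** * Essentially bounded random variables *)

(** The entries of the disturbances belong to this class, which is stable under
    sums and products: it contains all states, inputs and costs, and expectation
    is finite and linear on it. *)
Definition ess_bdd {d} {T : measurableType d} {R : realType}
    (Pr : probability T R) (f : T -> R) : Prop :=
  measurable_fun setT f /\ exists C : R, {ae Pr, forall w, `|f w| <= C}.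

Definition ess_bdd_mx {d} {T : measurableType d} {R : realType}
    (Pr : probability T R) (a b : nat) (F : T -> 'M[R]_(a, b)) : Prop :=
  forall i j, ess_bdd Pr (fun w => F w i j).

Definition centered_mx {d} {T : measurableType d} {R : realType}
    (Pr : probability T R) (a b : nat) (F : T -> 'M[R]_(a, b)) : Prop :=
  ess_bdd_mx Pr F /\ forall i j, \int[Pr]_w (F w i j) = 0.

Section EssBounded.
Context {d} {T : measurableType d} {R : realType} (Pr : probability T R).
Implicit Types f g : T -> R.

Lemma eq_ess_bdd f g : f =1 g -> ess_bdd Pr f -> ess_bdd Pr g.
Proof. by move=> /funext ->. Qed.

Lemma ess_bdd_cst (c : R) : ess_bdd Pr (cst c).
Proof. by split=> //; exists `|c|; apply: aeW. Qed.

Lemma ess_bddD f g : ess_bdd Pr f -> ess_bdd Pr g ->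
  ess_bdd Pr (fun w => f w + g w).
Proof.
move=> [mf [C fC]] [mg [D gD]]; split; first exact: measurable_funD.
exists (C + D); apply: filterS2 fC gD => w fC gD.
by rewrite (le_trans (ler_normD _ _))// lerD.
Qed.

Lemma ess_bddM f g : ess_bdd Pr f -> ess_bdd Pr g ->
  ess_bdd Pr (fun w => f w * g w).
Proof.
move=> [mf [C fC]] [mg [D gD]]; split; first exact: measurable_funM.
exists (C * D); apply: filterS2 fC gD => w fC gD.
by rewrite normrM ler_pM.
Qed.

Lemma ess_bddZ (c : R) f : ess_bdd Pr f -> ess_bdd Pr (fun w => c * f w).
Proof. exact/ess_bddM/ess_bdd_cst. Qed.

Lemma ess_bddB f g : ess_bdd Pr f -> ess_bdd Pr g ->
  ess_bdd Pr (fun w => f w - g w).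
Proof.
move=> bf bg; apply: eq_ess_bdd (ess_bddD bf (ess_bddZ (-1) bg)) => w.
by rewrite mulN1r.
Qed.

Lemma ess_bdd_sum (I : Type) (s : seq I) (p : pred I) (F : I -> T -> R) :
  (forall i, p i -> ess_bdd Pr (F i)) ->
  ess_bdd Pr (fun w => \sum_(i <- s | p i) F i w).
Proof.
move=> bF; elim: s => [|i s IHs].
  by apply: eq_ess_bdd (ess_bdd_cst 0) => w; rewrite big_nil.
case: (boolP (p i)) => pi.
  by apply: eq_ess_bdd (ess_bddD (bF i pi) IHs) => w; rewrite big_cons pi.
by apply: eq_ess_bdd IHs => w; rewrite big_cons (negbTE pi).
Qed.

Lemma ess_bdd_integrable f : ess_bdd Pr f -> Pr.-integrable setT (EFin \o f).
Proof.
move=> [mf [C fC]]; apply/integrableP; split; first exact/measurable_EFinP.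
apply: (@le_lt_trans _ _ (\int[Pr]_w (`|C|%R)%:E)%E).
  apply: ae_ge0_le_integral => //=.
    by apply/measurable_EFinP; exact: measurableT_comp.
  apply: filterS fC => w fC _.
  by rewrite lee_fin (le_trans fC) ?ler_norm.
by rewrite integral_cst//= probability_setT mule1 ltry.
Qed.

Lemma EFin_Rintegral f : ess_bdd Pr f ->
  (\int[Pr]_w (f w))%:E = (\int[Pr]_w (f w)%:E)%E.
Proof.
by move=> /ess_bdd_integrable bf; rewrite fineK// integrable_fin_num.
Qed.

Lemma RintegralTD f g : ess_bdd Pr f -> ess_bdd Pr g ->
  \int[Pr]_w (f w + g w) = \int[Pr]_w (f w) + \int[Pr]_w (g w).
Proof.
by move=> /ess_bdd_integrable ? /ess_bdd_integrable ?; apply: RintegralD.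
Qed.

Lemma RintegralTZ (c : R) f : ess_bdd Pr f ->
  \int[Pr]_w (c * f w) = c * \int[Pr]_w (f w).
Proof. by move=> /ess_bdd_integrable ?; apply: RintegralZl. Qed.

Lemma RintegralT_cst (c : R) : \int[Pr]_w c = c.
Proof. by rewrite Rintegral_cst//= probability_setT mulr1. Qed.

Lemma RintegralT_sum (I : Type) (s : seq I) (p : pred I) (F : I -> T -> R) :
  (forall i, p i -> ess_bdd Pr (F i)) ->
  \int[Pr]_w (\sum_(i <- s | p i) F i w) =
  \sum_(i <- s | p i) \int[Pr]_w (F i w).
Proof.
move=> bF; elim: s => [|i s IHs].
  under eq_Rintegral do rewrite big_nil.
  by rewrite RintegralT_cst big_nil.
under eq_Rintegral do rewrite big_cons.
rewrite big_cons; case: ifPn => // pi.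
rewrite RintegralTD ?IHs//; [exact: bF|exact: ess_bdd_sum].
Qed.

Lemma le_RintegralT f g : ess_bdd Pr f -> ess_bdd Pr g ->
  {ae Pr, forall w, f w <= g w} -> \int[Pr]_w (f w) <= \int[Pr]_w (g w).
Proof.
move=> bf bg fg.
have bh := ess_bddB bg bf.
rewrite -subr_ge0 -mulN1r -RintegralTZ// -RintegralTD//; last exact: ess_bddZ.
rewrite (_ : \int[Pr]_w _ = \int[Pr]_w (Num.max (g w - f w) 0)).
  by apply: Rintegral_ge0 => w _; rewrite le_max lexx orbT.
congr fine; apply: ae_eq_integral => //.
- by apply/measurable_EFinP; under eq_fun do rewrite mulN1r; case: bh.
- apply/measurable_EFinP; apply: measurable_maxr => //; by case: bh.
- apply: filterS fg => w fg _; rewrite mulN1r; congr EFin.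
  by apply/esym/max_idPl; rewrite subr_ge0.
Qed.

Lemma sub_ae (A B : set T) : A `<=` B ->
  {ae Pr, forall w, A w} -> {ae Pr, forall w, B w}.
Proof. exact: filterS. Qed.

Lemma ess_bdd_mx_cst (a b : nat) (M : 'M[R]_(a, b)) : ess_bdd_mx Pr (cst M).
Proof. by move=> i j; apply: ess_bdd_cst. Qed.

Lemma ess_bdd_mxD (a b : nat) (F H : T -> 'M[R]_(a, b)) :
  ess_bdd_mx Pr F -> ess_bdd_mx Pr H -> ess_bdd_mx Pr (fun w => F w + H w).
Proof.
move=> bF bH i j; apply: eq_ess_bdd (ess_bddD (bF i j) (bH i j)) => w.
by rewrite mxE.
Qed.

Lemma ess_bdd_mx_sum (I : Type) (s : seq I) (p : pred I) (a b : nat)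
    (F : I -> T -> 'M[R]_(a, b)) :
  (forall i, p i -> ess_bdd_mx Pr (F i)) ->
  ess_bdd_mx Pr (fun w => \sum_(i <- s | p i) F i w).
Proof.
move=> bF i j; apply: eq_ess_bdd (ess_bdd_sum s (fun k pk => bF k pk i j)) => w.
by rewrite summxE.
Qed.

Lemma ess_bdd_mxM (a b c : nat) (F : T -> 'M[R]_(a, b)) (H : T -> 'M[R]_(b, c)) :
  ess_bdd_mx Pr F -> ess_bdd_mx Pr H -> ess_bdd_mx Pr (fun w => F w *m H w).
Proof.
move=> bF bH i j.
apply: eq_ess_bdd (ess_bdd_sum _ (fun k _ => ess_bddM (bF i k) (bH k j))) => w.
by rewrite mxE.
Qed.

Lemma ess_bdd_mxMl (a b c : nat) (M : 'M[R]_(a, b)) (F : T -> 'M[R]_(b, c)) :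
  ess_bdd_mx Pr F -> ess_bdd_mx Pr (fun w => M *m F w).
Proof. exact/ess_bdd_mxM/ess_bdd_mx_cst. Qed.

Lemma ess_bdd_quad (a : nat) (M : 'M[R]_a) (F : T -> 'cV[R]_a) :
  ess_bdd_mx Pr F -> ess_bdd Pr (fun w => quad M (F w)).
Proof.
move=> bF; apply: (@ess_bdd_mxM 1 a 1 (fun w => (F w)^T *m M) F) => //.
apply: ess_bdd_mxM; last exact: ess_bdd_mx_cst.
by move=> i j; apply: eq_ess_bdd (bF j i) => w; rewrite mxE.
Qed.

Lemma centered_mx0 (a b : nat) : centered_mx Pr (fun=> 0 : 'M[R]_(a, b)).
Proof.
split; first exact: ess_bdd_mx_cst.
by move=> i j; rewrite RintegralT_cst mxE.
Qed.

Lemma centered_mxD (a b : nat) (F H : T -> 'M[R]_(a, b)) :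
  centered_mx Pr F -> centered_mx Pr H -> centered_mx Pr (fun w => F w + H w).
Proof.
move=> [bF F0] [bH H0]; split; first exact: ess_bdd_mxD.
move=> i j; under eq_Rintegral do rewrite mxE.
by rewrite RintegralTD// F0 H0 addr0.
Qed.

Lemma centered_mxMl (a b c : nat) (M : 'M[R]_(a, b)) (F : T -> 'M[R]_(b, c)) :
  centered_mx Pr F -> centered_mx Pr (fun w => M *m F w).
Proof.
move=> [bF F0]; split; first exact: ess_bdd_mxMl.
move=> i j; under eq_Rintegral do rewrite mxE.
rewrite RintegralT_sum; last by move=> k _; apply: ess_bddZ.
by apply: big1 => k _; rewrite RintegralTZ// F0 mulr0.
Qed.

Lemma centered_mx_sum (I : Type) (s : seq I) (p : pred I) (a b : nat)
    (F : I -> T -> 'M[R]_(a, b)) :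
  (forall i, p i -> centered_mx Pr (F i)) ->
  centered_mx Pr (fun w => \sum_(i <- s | p i) F i w).
Proof.
move=> bF; split.
  by apply: ess_bdd_mx_sum => i /bF[].
move=> i j; under eq_Rintegral do rewrite summxE.
rewrite RintegralT_sum; last by move=> k /bF[].
by apply: big1 => k /bF[].
Qed.

End EssBounded.

(** * Independent sequences *)

Section PathSpace.
Context {dT : measure_display} {T : measurableType dT} {R : realType}.

Lemma measurable_to_path (I : Type) {d} {X : measurableType d}
    (f : X -> path_space I T) :
  (forall i, measurable_fun setT (fun x => f x i)) -> measurable_fun setT f.
Proof.
move=> mf.
refine (@measurability _ _ X (path_space I T) setT f (@cylinders I dT T) _ _) => //.
move=> _ [_ [i _ [B mB <-]] <-].
have := mf i measurableT B mB.
by congr (measurable _); apply/seteqP; split => x /=; tauto.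
Qed.

(** The finite-dimensional rectangles form a pi-system that generates the
    sigma-algebra, and independence gives their probability as a product of
    marginal ones. *)
Lemma path_probability_unique (I : choiceType)
    (P1 P2 : probability (path_space I T) R) :
  independent_coords P1 -> independent_coords P2 ->
  (forall i E, measurable E -> P1 (@Defs.coord I dT T i @^-1` E) =
                               P2 (@Defs.coord I dT T i @^-1` E)) ->
  forall A, measurable A -> P1 A = P2 A.
Proof.
move=> ind1 ind2 P12.
pose cyl (K : {fset I}) (E : I -> set T) : set (path_space I T) :=
  \bigcap_(i in [set` K]) (@Defs.coord I dT T i @^-1` E i).
pose G := [set A | exists K E, (forall i, measurable (E i)) /\ A = cyl K E].
have mcyl K E : (forall i, measurable (E i)) -> measurable (cyl K E).
  move=> mE; apply: fin_bigcap_measurable; first exact: finite_fset.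
  by move=> i _; rewrite -[X in measurable X]setTI; exact: measurable_coord.
apply: (measure_unique G (fun=> setT)).
- apply/seteqP; split; last first.
    apply: smallest_sub; first exact: sigma_algebra_measurable.
    by move=> _ [K [E [mE ->]]]; apply: mcyl.
  apply: smallest_sub; first exact: smallest_sigma_algebra.
  move=> _ [i _ [B mB <-]]; apply: sub_sigma_algebra.
  exists [fset i]%fset, (fun=> B); split => //.
  rewrite setTI; apply/seteqP; split => w /=.
    by move=> wB j /=; rewrite inE => /eqP ->.
  by move=> /(_ i); apply; rewrite /= inE.
- move=> _ _ [K [E [mE ->]]] [L [F [mF ->]]].
  exists (K `|` L)%fset, (fun i => (if i \in K then E i else setT) `&`
                           (if i \in L then F i else setT)); split.
    by move=> i; apply: measurableI; case: ifP.
  apply/seteqP; split => w /=.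
    move=> [wK wL] i /= _; split; case: ifP => // iK.
      exact: wK.
    exact: wL.
  move=> wKL; split => i /= iK.
    have iKL : i \in (K `|` L)%fset by rewrite in_fsetU iK.
    by have := wKL i iKL; rewrite /= iK => -[].
  have iKL : i \in (K `|` L)%fset by rewrite in_fsetU iK orbT.
  by have := wKL i iKL; rewrite /= iK => -[].
- move=> _; exists fset0, (fun=> setT); split => //.
  by apply/seteqP; split => w //= _ i.
- by apply/seteqP; split => w // _; exists 0%N.
- move=> _ [K [E [mE ->]]].
  rewrite [LHS]ind1// [RHS]ind2//.
  by apply: eq_bigr => i _; apply: P12.
- by move=> _; rewrite (le_lt_trans (probability_le1 _ _)) ?ltry.
Qed.

End PathSpace.

Section InsertCoord.
Context {dT : measure_display} {T : measurableType dT}.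
Context {I J : choiceType} (h : J -> option I).

(** Coordinate [j] of the new sequence is either coordinate [h j] of the old one
    or, when [h j] is [None], a fresh variable. Choosing [h] gives in turn the
    replacement of one coordinate, the prepending of a disturbance and the
    restriction to finitely many coordinates. *)
Definition insert_coord (z : T * path_space I T) : path_space J T :=
  fun j => oapp (z.2 : I -> T) z.1 (h j).

Lemma measurable_insert_coord : measurable_fun setT insert_coord.
Proof.
apply: measurable_to_path => j; rewrite /insert_coord.
case: (h j) => [i|] /=; last exact: measurable_fst.
exact: (measurableT_comp (@measurable_coord I dT T i) measurable_snd).
Qed.

HB.instance Definition _ := isMeasurableFun.Build _ _ _ _
  insert_coord measurable_insert_coord.

Context {R : realType} (mu : probability T R)
  (Pr : probability (path_space I T) R).

Definition insert_law : probability (path_space J T) R :=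
  distribution (mu \x Pr)%E insert_coord.

Lemma insert_law_coord (j : J) (E : set T) : measurable E ->
  insert_law (@Defs.coord J dT T j @^-1` E) =
  if h j is Some i then Pr (@Defs.coord I dT T i @^-1` E) else mu E.
Proof.
move=> mE; rewrite /insert_law /distribution/= /pushforward/= -comp_preimage.
case hj : (h j) => [i|].
  have -> : (@Defs.coord J dT T j \o insert_coord) @^-1` E =
      setT `*` (@Defs.coord I dT T i @^-1` E).
    by apply/seteqP; split => -[t w];
    rewrite /= /Defs.coord/insert_coord hj /=; tauto.
  rewrite product_measure1E//.
    by rewrite -[RHS]mul1e; congr (_ * _)%E; exact: (probability_setT mu).
  by rewrite -[X in measurable X]setTI; exact: measurable_coord.
have -> : (@Defs.coord J dT T j \o insert_coord) @^-1` E = E `*` setT.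
  by apply/seteqP; split => -[t w];
    rewrite /= /Defs.coord/insert_coord hj /=; tauto.
rewrite product_measure1E// -[RHS]mule1; congr (_ * _)%E.
exact: (probability_setT Pr).
Qed.

(** Each old coordinate and the fresh variable are read at most once, so the
    preimage of a rectangle is a rectangle of the product space. *)
Lemma insert_law_indep (g : I -> J) :
  ocancel h g ->
  (forall j j', h j = None -> h j' = None -> j = j') ->
  independent_coords Pr -> independent_coords insert_law.
Proof.
move=> hK hN ind K E mE.
have hg j i : h j = Some i -> g i = j by move=> hj; have := hK j; rewrite hj.
under eq_bigr do rewrite insert_law_coord//.
pose K' := [fset i in pmap h K]%fset.
pose A1 := \bigcap_(j in [set j | j \in K /\ h j = None]) E j.
pose A2 : set (path_space I T) :=
  \bigcap_(i in [set` K']) (@Defs.coord I dT T i @^-1` E (g i)).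
rewrite /insert_law /distribution/= /pushforward/=.
have -> : insert_coord @^-1`
    (\bigcap_(i in [set` K]) (@Defs.coord J dT T i @^-1` E i))
    = A1 `*` A2.
  apply/seteqP; split => -[t w] /=.
    move=> tw; split => [j [jK hj]|i /=].
      by have := tw j jK; rewrite /= /Defs.coord /insert_coord hj.
    rewrite inE mem_pmap => /mapP[j jK /esym hj].
    by have := tw j jK; rewrite /= /Defs.coord /insert_coord hj /= (hg _ _ hj).
  move=> [tA wA] j /= jK; rewrite /Defs.coord /insert_coord.
  case hj : (h j) => [i|] /=; last by apply: tA.
  rewrite -(hg _ _ hj); apply: wA; rewrite /= inE mem_pmap.
  by apply/mapP; exists j.
have mA1 : measurable A1.
  apply: fin_bigcap_measurable => //.
  by apply: sub_finite_set (finite_fset K) => j [].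
have mA2 : measurable A2.
  apply: fin_bigcap_measurable; first exact: finite_fset.
  by move=> i _; rewrite -[X in measurable X]setTI; exact: measurable_coord.
rewrite product_measure1E//.
transitivity (mu A1 *
    \prod_(i <- K') Pr (@Defs.coord I dT T i @^-1` E (g i)))%E.
  by congr (_ * _)%E; apply: (ind K' (fun i => E (g i))) => i; apply: mE.
transitivity (\prod_(j <- K) (oapp (fun=> 1) (mu (E j)) (h j) *
    oapp (fun i => Pr (@Defs.coord I dT T i @^-1` E (g i))) 1 (h j)))%E; last first.
  apply: eq_bigr => j _; case hj : (h j) => [i|] /=; last by rewrite mule1.
  by rewrite mul1e (hg _ _ hj).
rewrite big_split/=; congr (_ * _)%E; last first.
  rewrite -big_pmap; apply: perm_big; apply: uniq_perm => //.
    by apply: pmap_uniq hK _ _.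
  by move=> i; rewrite inE.
case: (pselect (exists j, j \in K /\ h j = None)) => [[j [jK hj]]|nj].
  rewrite (bigD1_seq j)//= hj/= big1 ?mule1.
    congr (mu _); apply/seteqP; split => [t|t tE j' [_ hj']].
      by apply.
    by rewrite (hN _ _ hj' hj).
  move=> j' j'j; case hj' : (h j') => [i|] //=.
  by rewrite (hN _ _ hj' hj) eqxx in j'j.
rewrite big1_seq.
  rewrite (_ : A1 = setT); first exact: (probability_setT mu).
  by apply/seteqP; split => // t _ j jK; case: nj; exists j.
move=> j /= jK; case hj : (h j) => [i|] //=.
by case: nj; exists j.
Qed.

End InsertCoord.

Section Resample.
Context {dT : measure_display} {T : measurableType dT} {R : realType}.
Context {I : choiceType}.

Definition upd (w : path_space I T) (i : I) (t : T) : path_space I T :=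
  fun j => if j == i then t else w j.

Lemma measurable_upd (i : I) :
  measurable_fun setT (fun z : T * path_space I T => upd z.2 i z.1).
Proof.
apply: measurable_to_path => j; rewrite /upd.
case: eqP => _; first exact: measurable_fst.
exact: (measurableT_comp (@measurable_coord I dT T j) measurable_snd).
Qed.

Lemma measurable_resample (mu : probability T R) (i : I)
    (f : path_space I T -> \bar R) :
  measurable_fun setT f -> (forall w, 0 <= f w)%E ->
  measurable_fun setT (fun w => \int[mu]_t f (upd w i t))%E.
Proof.
move=> mf f0.
apply: (@measurable_fun_fubini_tonelli_G _ _ _ _ _ mu
  (fun z : T * path_space I T => f (upd z.2 i z.1))) => //.
exact: measurableT_comp mf (measurable_upd i).
Qed.

(** Replacing one coordinate by an independent copy does not change the law. This
    is how conditioning on the other coordinates is expressed here: the inner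
    integral plays the part of the conditional expectation. *)
Lemma integral_resample (Pr : probability (path_space I T) R) (i : I)
    (f : path_space I T -> \bar R) :
  independent_coords Pr -> measurable_fun setT f -> (forall w, 0 <= f w)%E ->
  (\int[Pr]_w f w =
   \int[Pr]_w \int[distribution Pr (@Defs.coord I dT T i)]_t f (upd w i t))%E.
Proof.
move=> ind mf f0.
set mu := distribution Pr _.
pose h (j : I) := if j == i then None else Some j.
have hK : ocancel h id by move=> j; rewrite /h; case: eqP.
have hN j j' : h j = None -> h j' = None -> j = j'.
  by rewrite /h; case: eqP => // ->; case: eqP => // ->.
have insE : insert_coord h = (fun z : T * path_space I T => upd z.2 i z.1).
  apply/funext => z; apply/funext => j; rewrite /insert_coord /h /upd.
  by case: eqP.
have lawE A : measurable A -> insert_law h mu Pr A = Pr A.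
  apply: path_probability_unique => //.
    exact: insert_law_indep hK hN ind.
  move=> j E mE; rewrite insert_law_coord// /h; case: eqP => [->|//].
  by [].
transitivity (\int[insert_law h mu Pr]_w f w)%E.
  by apply: eq_measure_integral => A mA _; apply/esym/lawE.
rewrite ge0_integral_distribution//.
rewrite fubini_tonelli2//=.
  by rewrite insE.
exact: measurableT_comp mf (measurable_insert_coord h).
Qed.

End Resample.

(** * Quadratic forms *)

Section Quad.
Context {R : realType}.

Lemma quadE (k : nat) (M : 'M[R]_k) (x : 'cV[R]_k) :
  quad M x = \sum_i \sum_j M i j * (x i 0 * x j 0).
Proof.
rewrite /quad mxE exchange_big; apply: eq_bigr => j _.
rewrite mxE mulr_suml; apply: eq_bigr => i _; rewrite mxE.
by rewrite mulrAC mulrC.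
Qed.

Lemma quadD (k : nat) (M : 'M[R]_k) (x y : 'cV[R]_k) : M^T = M ->
  quad M (x + y) = quad M x + 2 * (x^T *m M *m y) 0 0 + quad M y.
Proof.
move=> MT; rewrite /quad [(x + y)^T]raddfD/= !mulmxDl !mulmxDr.
have -> : y^T *m M *m x = (x^T *m M *m y)^T.
  by rewrite !trmx_mul trmxK MT mulmxA.
by rewrite !mxE; ring.
Qed.

Lemma quadM (k l : nat) (M : 'M[R]_k) (L : 'M[R]_(k, l)) (x : 'cV[R]_l) :
  quad M (L *m x) = quad (L^T *m M *m L) x.
Proof. by rewrite /quad trmx_mul !mulmxA. Qed.

Lemma psd_congr (k l : nat) (M : 'M[R]_k) (L : 'M[R]_(k, l)) :
  psd M -> psd (L^T *m M *m L).
Proof.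
move=> [MT M0]; split; first by rewrite !trmx_mul trmxK MT mulmxA.
by move=> x; rewrite -quadM.
Qed.

Lemma quadZ (k : nat) (M : 'M[R]_k) (a : R) (x : 'cV[R]_k) :
  quad M (a *: x) = a ^+ 2 * quad M x.
Proof.
by rewrite /quad [(a *: x)^T]linearZ/= -!scalemxAl -scalemxAr !mxE; ring.
Qed.

Lemma quad_mxD (k : nat) (M M' : 'M[R]_k) (x : 'cV[R]_k) :
  quad (M + M') x = quad M x + quad M' x.
Proof. by rewrite /quad mulmxDr mulmxDl mxE. Qed.

Lemma quad_mxN (k : nat) (M : 'M[R]_k) (x : 'cV[R]_k) :
  quad (- M) x = - quad M x.
Proof. by rewrite /quad mulmxN mulNmx mxE. Qed.

Lemma sqnorm_ge0 (k : nat) (x : 'cV[R]_k) : 0 <= sqnorm x.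
Proof. by apply: sumr_ge0 => i _; apply: sqr_ge0. Qed.

Lemma sqr_le_sqnorm (k : nat) (x : 'cV[R]_k) i : x i 0 ^+ 2 <= sqnorm x.
Proof.
rewrite /sqnorm (bigD1 i)//= lerDl.
by apply: sumr_ge0 => j _; apply: sqr_ge0.
Qed.

Lemma quad_le_sqnorm (k : nat) (M : 'M[R]_k) (x : 'cV[R]_k) :
  quad M x <= (\sum_i \sum_j `|M i j|) * sqnorm x.
Proof.
rewrite quadE mulr_suml; apply: ler_sum => i _.
rewrite mulr_suml; apply: ler_sum => j _.
apply: (le_trans (ler_norm _)); rewrite normrM ler_wpM2l//.
have xi := sqr_le_sqnorm x i; have xj := sqr_le_sqnorm x j.
rewrite ler_norml; apply/andP.
have := sqr_ge0 (x i 0 + x j 0); have := sqr_ge0 (x i 0 - x j 0).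
by split; nra.
Qed.

(** The form is nonnegative on all combinations [s x + t y]. *)
Lemma psd_cauchy_schwarz (k : nat) (M : 'M[R]_k) (x y : 'cV[R]_k) : psd M ->
  ((x^T *m M *m y) 0 0) ^+ 2 <= quad M x * quad M y.
Proof.
move=> [MT M0]; set b := (x^T *m M *m y) 0 0.
have sc a (L : 'M[R]_1) : (a *: L) 0 0 = a * L 0 0 by rewrite mxE.
have h (s t : R) : 0 <= s ^+ 2 * quad M x + 2 * (s * t * b) + t ^+ 2 * quad M y.
  have := M0 (s *: x + t *: y); rewrite quadD// !quadZ.
  rewrite [(s *: x)^T]linearZ/= -!scalemxAl -scalemxAr.
  by rewrite !sc -/b [s * (t * b)]mulrA.
have qx := M0 x; have qy := M0 y.
have [qx0|qx0] := eqVneq (quad M x) 0.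
  rewrite qx0 mul0r; have [->|b0] := eqVneq b 0; first by rewrite expr0n.
  (* With [quad M x = 0] the form at [t = 1] is affine in [s]: this [s] makes it -1. *)
  have := h (- ((quad M y + 1) / (2 * b))) 1; rewrite qx0.
  have -> : - ((quad M y + 1) / (2 * b)) * 1 * b = - ((quad M y + 1) / 2).
    by field.
  by lra.
have := h (- b) (quad M x).
have {}qx0 : 0 < quad M x by rewrite lt0r qx0.
move=> h1; rewrite -subr_ge0 -(pmulr_rge0 _ qx0).
by apply: le_trans h1 _; rewrite le_eqVlt; apply/orP; left; apply/eqP; ring.
Qed.

(** A positive definite [Q] is invertible, and Cauchy-Schwarz for the inner
    product of [Q] bounds every coordinate [x_i = (Q^-1 e_i)' Q x] by a multiple
    of the square root of the form. *)
Lemma posdef_coercive (k : nat) (Q : 'M[R]_k) : posdef Q ->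
  exists2 c : R, 0 < c & forall x, c * sqnorm x <= quad Q x.
Proof.
move=> [QT Q0].
have psdQ : psd Q.
  split=> // x; have [->|/Q0/ltW//] := eqVneq x 0.
  by rewrite /quad mulmx0 mxE.
have uQ : Q \in unitmx.
  rewrite unitmxE unitfE; apply/negP => /det0P[v v0 vQ].
  have := Q0 v^T; rewrite /quad trmxK vQ mul0mx mxE ltxx => h.
  have : false by apply: h; apply: contra_neq v0 => vT; rewrite -[v]trmxK vT trmx0.
  by [].
pose e i : 'cV[R]_k := invmx Q *m delta_mx i 0.
pose C := \sum_i quad Q (e i).
have C0 : 0 <= C by apply: sumr_ge0 => i _; case: psdQ.
have xle x : sqnorm x <= C * quad Q x.
  rewrite /sqnorm mulr_suml; apply: ler_sum => i _.
  have -> : x i 0 = ((e i)^T *m Q *m x) 0 0.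
    rewrite /e trmx_mul trmx_inv QT -mulmxA -mulmxA (mulmxA (invmx Q)).
    by rewrite mulVmx// mul1mx trmx_delta -rowE mxE.
  exact: psd_cauchy_schwarz.
exists (C + 1)^-1; first by rewrite invr_gt0; lra.
move=> x; rewrite mulrC ler_pdivrMr; last by lra.
by have := xle x; have := psdQ.2 x; nra.
Qed.

Lemma bounded_set_entries (k : nat) (S : set 'cV[R]_k) : bounded_set S ->
  exists K : R, forall x, S x -> forall i, `|x i 0| <= K.
Proof.
move=> [M [_ SM]]; exists (M + 1) => x Sx i.
have := SM (M + 1) _ x Sx; rewrite ltrDl ltr01 => /(_ isT).
apply: le_trans; rewrite [leRHS]/Num.norm/= mx_normrE.
exact: (le_bigmax _ (fun ij => `|x ij.1 ij.2|) (i, 0)).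
Qed.

Lemma interior_entries (k : nat) (S : set 'cV[R]_k) : interior S 0 ->
  exists2 r : R, 0 < r & forall x : 'cV[R]_k, (forall i, `|x i 0| < r) -> S x.
Proof.
move=> /nbhs_ballP[r /= r0 rS]; exists r => // x xr; apply: rS.
split=> // i j; rewrite (ord1 j) mxE /ball/= sub0r normrN; exact: xr.
Qed.

Lemma le_quad_entries (k : nat) (M : 'M[R]_k) (K : R) (x : 'cV[R]_k) :
  (forall i, `|x i 0| <= K) ->
  quad M x <= (\sum_i \sum_j `|M i j|) * (k%:R * K ^+ 2).
Proof.
move=> xK; apply: (le_trans (quad_le_sqnorm M x)).
apply: ler_wpM2l; first by apply: sumr_ge0 => i _; apply: sumr_ge0.
rewrite /sqnorm -[k in k%:R]card_ord -sumr_const mulr_suml.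
apply: ler_sum => i _; rewrite mul1r -real_normK ?num_real//.
by rewrite ler_sqr ?nnegrE// (le_trans _ (xK i)).
Qed.

End Quad.

(** * Moments of the disturbances *)

Section Moments.
Context {R : realType} {q : nat}.
Implicit Types (W : set 'cV[R]_q) (mu : probability (borel 'cV[R]_q) R).

Lemma measurable_entry (i : 'I_q) (j : 'I_1) :
  measurable_fun setT (fun w : borel 'cV[R]_q => (w : 'cV[R]_q) i j).
Proof.
refine (@measurability _ _ (borel 'cV[R]_q) R setT _ _
  (RGenOInfty.measurableE R) _) => //.
move=> _ [_ [x ->] <-]; rewrite setTI; apply: sub_sigma_algebra => /=.
by apply: open_comp; [move=> w _; exact: coord_continuous | exact: rray_open].
Qed.

Lemma zero_mean_entries W mu : bounded_set W -> zero_mean_on W mu ->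
  centered_mx mu (fun w : borel 'cV[R]_q => (w : 'cV[R]_q)).
Proof.
move=> bW [mu0 muW]; split.
  move=> i j; split; first exact: measurable_entry.
  have [K WK] := bounded_set_entries bW.
  by exists K; apply: sub_ae muW => w Ww; rewrite (ord1 j); exact: WK.
move=> i j; rewrite (ord1 j); have := mu0 i; rewrite unlock /Rintegral => ->.
by [].
Qed.

Lemma Rintegral_quad W mu (M : 'M[R]_q) : bounded_set W -> zero_mean_on W mu ->
  \int[mu]_w (quad M (w : 'cV[R]_q)) = \tr (M *m second_moment mu).
Proof.
move=> bW zmu; have [bmu _] := zero_mean_entries bW zmu.
under eq_Rintegral do rewrite quadE.
rewrite RintegralT_sum; last first.
  move=> i _; apply: ess_bdd_sum => j _; apply: ess_bddZ.
  by apply: ess_bddM; apply: bmu.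
apply: eq_bigr => i _; rewrite mxE RintegralT_sum; last first.
  by move=> j _; apply: ess_bddZ; apply: ess_bddM; apply: bmu.
apply: eq_bigr => j _; rewrite RintegralTZ; last first.
  by apply: ess_bddM; apply: bmu.
rewrite mxE unlock; congr (_ * fine _).
by apply: eq_integral => w _; rewrite mulrC.
Qed.

(** For [M = G' P G] this is the largest expected terminal cost that one
    disturbance can add. *)
Definition worst_trace (M : 'M[R]_q) (d : R * 'M[R]_q) : R :=
  sup [set \tr (M *m S) | S in cov_ball d].

(** Every covariance of the ball is that of a law on the bounded set [W], so the
    traces are bounded and their supremum is an upper bound. *)
Lemma Rintegral_quad_le W mu (M : 'M[R]_q) d : bounded_set W ->
  admissible W d -> ambiguity W d mu ->
  \int[mu]_w (quad M (w : 'cV[R]_q)) <= worst_trace M d.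
Proof.
move=> bW [_ _ adm] [zmu cmu]; rewrite (Rintegral_quad _ bW zmu).
apply: ub_le_sup; last by exists (second_moment mu).
have [K WK] := bounded_set_entries bW.
exists ((\sum_i \sum_j `|M i j|) * (q%:R * K ^+ 2)) => _ [S /adm[nu znu <-] <-].
have [bnu _] := zero_mean_entries bW znu.
rewrite -(Rintegral_quad _ bW znu) -[leRHS](RintegralT_cst nu).
apply: le_RintegralT; [exact: ess_bdd_quad|exact: ess_bdd_cst|].
by case: znu => _; apply: sub_ae => w /WK; exact: le_quad_entries.
Qed.

Lemma worst_trace_ge0 W mu (M : 'M[R]_q) d : bounded_set W ->
  admissible W d -> ambiguity W d mu -> psd M -> 0 <= worst_trace M d.
Proof.
move=> bW adm amu [_ M0]; apply: le_trans (Rintegral_quad_le M bW adm amu).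
by apply: Rintegral_ge0 => w _; exact: M0.
Qed.

Lemma Rintegral_quadD {d} {T : measurableType d} (Pr : probability T R)
    (n : nat) (P : 'M[R]_n) (y : 'cV[R]_n) (F : T -> 'cV[R]_n) :
  P^T = P -> centered_mx Pr F ->
  \int[Pr]_w (quad P (y + F w)) = quad P y + \int[Pr]_w (quad P (F w)).
Proof.
move=> PT cF; have [bF _] := cF.
have [bL cL] := centered_mxMl (y^T *m P) cF.
under eq_Rintegral do rewrite quadD// -addrA.
have bL2 : ess_bdd Pr (fun w => 2 * (y^T *m P *m F w) 0 0) by exact: ess_bddZ.
rewrite RintegralTD//; [|exact: ess_bdd_cst|].
  rewrite RintegralTD//; last exact: ess_bdd_quad.
  by rewrite RintegralT_cst RintegralTZ// cL mulr0 add0r.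
by apply: ess_bddD => //; exact: ess_bdd_quad.
Qed.

Lemma Rintegral_step_le W mu d (n : nat) (P : 'M[R]_n) (G : 'M[R]_(n, q))
    (y : 'cV[R]_n) : bounded_set W -> admissible W d -> ambiguity W d mu ->
  P^T = P ->
  \int[mu]_w (quad P (y + G *m (w : 'cV[R]_q))) <=
  quad P y + worst_trace (G^T *m P *m G) d.
Proof.
move=> bW adm amu PT; have [zmu _] := amu.
rewrite Rintegral_quadD//; last first.
  by apply: centered_mxMl; exact: zero_mean_entries bW zmu.
rewrite lerD2l; under eq_Rintegral do rewrite quadM.
exact: Rintegral_quad_le bW adm amu.
Qed.

End Moments.

Section SeqMoments.
Context {R : realType} {q : nat} {I : choiceType}.
Local Notation T := (borel 'cV[R]_q).
Context (W : set 'cV[R]_q) (d : R * 'M[R]_q).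
Hypotheses (bW : bounded_set W) (adm : admissible W d).
Context (Pr : probability (path_space I T) R).
Hypothesis sPr : seq_ambiguity I W d Pr.

Lemma ae_coord (i : I) (A : set T) :
  {ae distribution Pr (@Defs.coord I _ T i), forall t, A t} ->
  {ae Pr, forall w : path_space I T, A (w i)}.
Proof.
move=> [N [mN N0 NA]]; exists (@Defs.coord I _ T i @^-1` N); split.
- by rewrite -[X in measurable X]setTI; exact: measurable_coord.
- exact: N0.
- by move=> w wA; apply: NA.
Qed.

Lemma centered_coord (i : I) :
  centered_mx Pr (fun w : path_space I T => (w i : 'cV[R]_q)).
Proof.
have [_ /(_ i) [zmu _]] := sPr.
have [bmu cmu] := zero_mean_entries bW zmu.
have bPr : ess_bdd_mx Pr (fun w : path_space I T => (w i : 'cV[R]_q)).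
  move=> a b; have [mab [C aeC]] := bmu a b; split.
    exact: measurableT_comp mab (@measurable_coord I _ T i).
  by exists C; apply: (@ae_coord i [set t : T | `|(t : 'cV[R]_q) a b| <= C]).
split=> // a b; rewrite -(cmu a b); congr fine.
rewrite integral_distribution//.
  by have [m _] := bmu a b; exact/measurable_EFinP.
exact: (ess_bdd_integrable (bPr a b)).
Qed.

(** The state [y] does not look at coordinate [i], so given the other coordinates
    the disturbance is centered and only its second moment contributes. *)
Lemma Rintegral_path_step_le (i : I) (n : nat) (P : 'M[R]_n)
    (G : 'M[R]_(n, q)) (y : path_space I T -> 'cV[R]_n) : psd P ->
  ess_bdd_mx Pr y -> (forall w t, y (upd w i t) = y w) ->
  \int[Pr]_w (quad P (y w + G *m (w i : 'cV[R]_q))) <=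
  \int[Pr]_w (quad P (y w)) + worst_trace (G^T *m P *m G) d.
Proof.
move=> [PT P0] by_ yi; have [ind /(_ i) amu] := sPr; have [zmu _] := amu.
have bi : ess_bdd_mx Pr (fun w : path_space I T => (w i : 'cV[R]_q)).
  by have [] := centered_coord i.
have bst : ess_bdd Pr (fun w => quad P (y w + G *m (w i : 'cV[R]_q))).
  by apply: ess_bdd_quad; apply: ess_bdd_mxD => //; exact: ess_bdd_mxMl.
have bq : ess_bdd Pr (fun w => quad P (y w)) by exact: ess_bdd_quad.
rewrite -[X in _ + X](RintegralT_cst Pr) -RintegralTD//; last exact: ess_bdd_cst.
rewrite -lee_fin EFin_Rintegral// EFin_Rintegral; last first.
  by apply: ess_bddD => //; exact: ess_bdd_cst.
rewrite (@integral_resample _ _ _ _ Pr i)//; last first.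
- by move=> w; rewrite lee_fin.
- by apply/measurable_EFinP; case: bst.
have Pr1 w : (\int[distribution Pr (@Defs.coord I _ T i)]_t
    (quad P (y (upd w i t) + G *m ((upd w i t) i : 'cV[R]_q)))%:E <=
    (quad P (y w) + worst_trace (G^T *m P *m G) d)%:E)%E.
  under eq_integral do rewrite yi /upd eqxx.
  rewrite -EFin_Rintegral.
    by rewrite lee_fin; exact: Rintegral_step_le bW adm amu _.
  apply: ess_bdd_quad; apply: ess_bdd_mxD; first exact: ess_bdd_mx_cst.
  by apply: ess_bdd_mxMl; have [] := zero_mean_entries bW zmu.
apply: ge0_le_integral => //.
- by move=> w _; apply: integral_ge0 => t _; rewrite lee_fin.
- apply: (@measurable_resample _ _ _ _ _ i
    (fun w => (quad P (y w + G *m (w i : 'cV[R]_q)))%:E)).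
    by apply/measurable_EFinP; case: bst.
  by move=> w; rewrite lee_fin.
- apply/measurable_EFinP; apply: measurable_funD => //; by case: bq.
Qed.

End SeqMoments.

Lemma ae_path {R : realType} {q : nat} {I : countType} (W : set 'cV[R]_q)
    (d : R * 'M[R]_q) (Pr : probability (path_space I (borel 'cV[R]_q)) R) :
  seq_ambiguity I W d Pr ->
  {ae Pr, forall w : path_space I (borel 'cV[R]_q), forall i, W (w i)}.
Proof.
move=> [_ amb].
have : {ae Pr, forall w : path_space I (borel 'cV[R]_q), forall n i,
    @choice.pickle_inv I n = Some i -> W (w i)}.
  apply: ae_foralln => n; case: choice.pickle_inv => [i|]; last by apply: aeW.
  have [[_ aeW_] _] := amb i.
  by apply: sub_ae (ae_coord aeW_) => w Wi _ [<-].
by apply: sub_ae => w Ww i; exact: (Ww (choice.pickle i) i (choice.pickleK_inv i)).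
Qed.

(** * Policies and open-loop trajectories *)

Section OpenLoop.
Context {R : realType} {n m q : nat}.
Implicit Types (s : mpc R n m q).

Lemma ext0E (V : nmodType) (N : nat) (f : 'I_N -> V) (i : 'I_N) :
  ext0 f i = f i.
Proof. by rewrite /ext0 valK. Qed.

Lemma trajectoryD s (x x' : 'cV[R]_n) u u' w w' (k : nat) :
  trajectory s (x + x') (fun i => u i + u' i) (fun i => w i + w' i) k =
  trajectory s x u w k + trajectory s x' u' w' k.
Proof.
elim: k => //= k ->.
by rewrite !mulmxDr [X in X + _ = _]addrACA [LHS]addrACA.
Qed.

Lemma ol_inputE N (th : policy R m q N) w (i : 'I_N) : causal th ->
  ol_input th w i = th.2 i + \sum_j th.1 i j *m w j.
Proof.
move=> cth; rewrite /ol_input; congr (_ + _).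
rewrite [RHS](bigID (fun j : 'I_N => (j < i)%N))/= [X in _ + X]big1 ?addr0//.
by move=> j; rewrite -leqNgt => /cth ->; rewrite mul0mx.
Qed.

Lemma ol_input0 N (th : policy R m q N) (i : 'I_N) :
  ol_input th (fun=> 0) i = th.2 i.
Proof.
by rewrite /ol_input big1 ?addr0// => j _; rewrite mulmx0.
Qed.

Lemma ol_input_split N (th : policy R m q N) w (i : 'I_N) :
  ol_input th w i = th.2 i + ol_input (th.1, fun=> 0) w i.
Proof. by rewrite /ol_input/= add0r. Qed.

(** The nominal trajectory and the response to the disturbances separate; the
    response depends on the gains only. *)
Lemma ol_state_split s x th w (k : nat) :
  ol_state s x th w k =
  ol_state s x th (fun=> 0) k + ol_state s 0 (th.1, fun=> 0) w k.
Proof.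
rewrite /ol_state -[in LHS](addr0 x) -trajectoryD.
congr (trajectory s _ _ _ _); apply/funext => i; rewrite /ext0.
  case: insubP => [j _ _|]; last by rewrite addr0.
  by rewrite ol_input0 -ol_input_split.
by case: insubP => [j _ _|]; rewrite add0r.
Qed.

Lemma ol_state_affine s x th (k : nat) :
  exists c F, forall w, ol_state s x th w k = c + \sum_j F j *m w j.
Proof.
elim: k => [|k [c [F cF]]].
  exists x, (fun=> 0) => w.
  by rewrite big1 ?addr0// => j _; rewrite mul0mx.
have cFS D H (c' : 'cV[R]_m) (w : 'I_(mpcN s) -> 'cV[R]_q) :
    mpcA s *m (c + \sum_j F j *m w j) + mpcB s *m (c' + \sum_j D j *m w j) +
      mpcG s *m (\sum_j H j *m w j) =
    (mpcA s *m c + mpcB s *m c') +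
      \sum_j (mpcA s *m F j + mpcB s *m D j + mpcG s *m H j) *m w j.
  rewrite !mulmxDr !mulmx_sumr addrACA -[LHS]addrA; congr (_ + _).
  rewrite -!big_split/=; apply: eq_bigr => j _.
  by rewrite !mulmxDl !mulmxA.
case: (boolP (k < mpcN s)%N) => kN; last first.
  exists (mpcA s *m c + mpcB s *m 0),
    (fun j => mpcA s *m F j + mpcB s *m 0 + mpcG s *m 0) => w.
  rewrite -(cFS (fun=> 0) (fun=> 0) 0) -cF /ol_state/= /ext0 insubN//.
  by rewrite add0r !big1// => j _; rewrite mul0mx.
pose i := Ordinal kN.
exists (mpcA s *m c + mpcB s *m th.2 i),
  (fun j => mpcA s *m F j + mpcB s *m (if (j < i)%N then th.1 i j else 0) +
            mpcG s *m (if j == i then 1%:M else 0)) => w.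
rewrite -(cFS (fun j => if (j < i)%N then th.1 i j else 0)
  (fun j => if j == i then 1%:M else 0)) -cF /ol_state/=.
rewrite -[k in ext0 (ol_input _ _) k]/(val i) -[k in ext0 w k]/(val i).
rewrite !ext0E {2}/ol_input.
congr (_ + _); [congr (_ + _)|]; congr (mulmx _ _).
  congr (_ + _); rewrite big_mkcond/=; apply: eq_bigr => j _.
  by case: ifP => // _; rewrite mul0mx.
rewrite (bigD1 i)//= eqxx mul1mx big1 ?addr0// => j /negbTE ->.
by rewrite mul0mx.
Qed.

Definition entries_le (k : nat) (K : R) (x : 'cV[R]_k) : Prop :=
  forall i, `|x i 0| <= K.

Lemma entries_leD (k : nat) (K K' : R) (x y : 'cV[R]_k) :
  entries_le K x -> entries_le K' y -> entries_le (K + K') (x + y).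
Proof.
move=> xK yK i; rewrite mxE; apply: (le_trans (ler_normD _ _)).
exact: lerD.
Qed.

Lemma entries_leM (k l : nat) (M : 'M[R]_(k, l)) (K : R) (x : 'cV[R]_l) :
  entries_le K x -> entries_le (\sum_i \sum_j (`|M i j| * K)) (M *m x).
Proof.
move=> xK i; rewrite mxE.
have K0 j : 0 <= `|M i j| * K.
  by rewrite mulr_ge0// (le_trans _ (xK j)).
apply: (@le_trans _ _ (\sum_j (`|M i j| * K))).
  apply: (le_trans (ler_norm_sum _ _ _)); apply: ler_sum => j _.
  by rewrite normrM ler_wpM2l//; exact: xK.
rewrite (bigD1 i)//= lerDl; apply: sumr_ge0 => i' _; apply: sumr_ge0 => j _.
by rewrite mulr_ge0// (le_trans _ (xK j)).
Qed.

Lemma trajectory_bound s (K : R) (k : nat) :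
  exists K', forall x u w, entries_le K x ->
    (forall i, (i < k)%N -> entries_le K (u i)) ->
    (forall i, (i < k)%N -> entries_le K (w i)) ->
    entries_le K' (trajectory s x u w k).
Proof.
elim: k => [|k [K' IH]]; first by exists K.
pose b a a' (M : 'M[R]_(a, a')) C := \sum_i \sum_j (`|M i j| * C).
exists (b _ _ (mpcA s) K' + b _ _ (mpcB s) K + b _ _ (mpcG s) K).
move=> x u w xK uK wK /=.
apply: entries_leD; last by apply: entries_leM; exact: wK.
apply: entries_leD; last by apply: entries_leM; exact: uK.
by apply: entries_leM; apply: IH => // i ik; [apply: uK|apply: wK]; exact: ltnW.
Qed.

Lemma total_cost_ge0 s x th w : psd (mpcQ s) -> psd (mpcR s) -> psd (mpcP s) ->
  0 <= total_cost s x th w.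
Proof.
move=> [_ Q0] [_ R0] [_ P0]; apply: addr_ge0 => //.
by apply: sumr_ge0 => k _; apply: addr_ge0.
Qed.

(** Feasible inputs stay in the bounded set [U], which bounds the costs of all
    feasible policies at once without bounding their gains. *)
Lemma feasible_cost_bound s (K : R) : bounded_set (mpcU s) ->
  bounded_set (mpcW s) -> (forall x u, mpcZ s (x, u) -> mpcU s u) ->
  exists C : R, forall x, entries_le K x ->
    forall th, feasible_policies s x th ->
    forall w, (forall i, mpcW s (w i)) -> total_cost s x th w <= C.
Proof.
move=> /bounded_set_entries[KU UK] /bounded_set_entries[KW WK] ZU.
pose K0 := Num.max `|K| (Num.max `|KU| `|KW|).
have Kle L a (x : 'cV[R]_a) : entries_le L x -> `|L| <= K0 -> entries_le K0 x.
  move=> xL LK i; apply: le_trans (xL i) _.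
  by apply: le_trans (ler_norm L) LK.
have /choice[K1 K1P] := trajectory_bound s K0.
pose b a (M : 'M[R]_a) C := (\sum_i \sum_j `|M i j|) * (a%:R * C ^+ 2).
exists (\sum_(k < mpcN s) (b _ (mpcQ s) (K1 k) + b _ (mpcR s) K0) +
        b _ (mpcP s) (K1 (mpcN s))).
move=> x xK th [cth fth] w wW; have [Zk Xf] := fth w wW.
have uK i : entries_le K0 (ol_input th w i).
  apply: (Kle KU); first by apply: UK; exact: ZU (Zk i).
  by rewrite !le_max lexx orbT.
have bx k : (k <= mpcN s)%N -> entries_le (K1 k) (ol_state s x th w k).
  move=> kN; apply: K1P.
  - by apply: Kle xK _; rewrite !le_max lexx.
  - move=> i ik; rewrite -[i]/(val (Ordinal (leq_trans ik kN))) ext0E.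
    exact: uK.
  - move=> i ik; rewrite -[i]/(val (Ordinal (leq_trans ik kN))) ext0E.
    apply: (Kle KW); first exact: WK.
    by rewrite !le_max lexx !orbT.
apply: lerD; last by apply: le_quad_entries; exact: bx.
apply: ler_sum => k _; apply: lerD; apply: le_quad_entries.
  exact/bx/ltnW.
exact: uK.
Qed.

End OpenLoop.

Lemma lyapunov_le {R : realType} {n m : nat} (A : 'M[R]_n) (B : 'M[R]_(n, m))
    (Q P : 'M[R]_n) (Ru : 'M[R]_m) (Kf : 'M[R]_(m, n)) y :
  loewner_le ((A + B *m Kf)^T *m P *m (A + B *m Kf)) (P - Q - Kf^T *m Ru *m Kf) ->
  quad Q y + quad Ru (Kf *m y) + quad P ((A + B *m Kf) *m y) <= quad P y.
Proof.
by move=> [_ /(_ y)]; rewrite !quad_mxD !quad_mxN -!quadM; lra.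
Qed.

(** * The shifted policy *)

Section Shift.
Context {R : realType} {n m q : nat}.
Context (A : 'M[R]_n) (B : 'M[R]_(n, m)) (G : 'M[R]_(n, q)).
Context (U : set 'cV[R]_m) (W : set 'cV[R]_q) (Z : set ('cV[R]_n * 'cV[R]_m)).
Context (Xf : set 'cV[R]_n) (N : nat) (Q : 'M[R]_n) (Ru : 'M[R]_m).
Context (P : 'M[R]_n).
Local Notation s := (MPC A B G U W Z Xf N.+1 Q Ru P).

Definition cons_index (i : 'I_N.+1) : option 'I_N.+1 :=
  omap (widen_ord (leqnSn N)) (unlift ord0 i).

(** The disturbances [w] relabelled for the run that started one step earlier:
    [t] comes first and the last entry of [w] lies beyond the horizon. *)
Definition cons_seq (t : 'cV[R]_q) (w : 'I_N.+1 -> 'cV[R]_q) (i : 'I_N.+1) :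
  'cV[R]_q := oapp w t (cons_index i).

Lemma cons_seq0 t w : cons_seq t w ord0 = t.
Proof. by rewrite /cons_seq /cons_index unlift_none. Qed.

Lemma cons_seq_lift t w (i : 'I_N) :
  cons_seq t w (lift ord0 i) = w (widen_ord (leqnSn N) i).
Proof. by rewrite /cons_seq /cons_index liftK. Qed.

Definition shift_gain (M : 'I_N.+1 -> 'I_N.+1 -> 'M[R]_(m, q))
    (D : 'I_N.+1 -> 'M[R]_(m, q)) (i j : 'I_N.+1) : 'M[R]_(m, q) :=
  if unlift ord_max j is Some j' then
    if unlift ord_max i is Some i' then M (lift ord0 i') (lift ord0 j')
    else D (lift ord0 j')
  else 0.

Definition shift_offset (th : policy R m q N.+1) (e : 'cV[R]_m)
    (D : 'I_N.+1 -> 'M[R]_(m, q)) (t : 'cV[R]_q) (i : 'I_N.+1) : 'cV[R]_m :=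
  if unlift ord_max i is Some i' then
    th.2 (lift ord0 i') + th.1 (lift ord0 i') ord0 *m t
  else e + D ord0 *m t.

(** The tail of [th] once the first disturbance [t] is known, completed by the
    input that is affine in the disturbances with offset [e] and gains [D].
    The gains do not involve [t]: this keeps the stochastic part of the
    worst-case cost independent of [t]. *)
Definition shift_policy (th : policy R m q N.+1) e D t : policy R m q N.+1 :=
  (shift_gain th.1 D, shift_offset th e D t).

Lemma causal_shift th e D t : causal th -> causal (shift_policy th e D t).
Proof.
move=> cth i j ij /=; rewrite /shift_gain.
case: unliftP => [j' jE|//]; case: unliftP => [i' iE|iE].
  by apply: cth; move: ij; rewrite iE jE !lift_max !lift0.
by move: ij; rewrite iE jE lift_max leqNgt ltn_ord.
Qed.

Lemma shift_sum (H : 'I_N.+1 -> 'M[R]_(m, q)) (a : 'cV[R]_m) t w :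
  (a + H ord0 *m t) +
    \sum_j (if unlift ord_max j is Some j' then H (lift ord0 j') else 0) *m w j =
  a + \sum_j H j *m cons_seq t w j.
Proof.
rewrite -addrA; congr (_ + _).
rewrite [RHS]big_ord_recl cons_seq0; congr (_ + _).
rewrite big_ord_recr/= unlift_none mul0mx addr0.
apply: eq_bigr => j _; rewrite cons_seq_lift.
have -> : widen_ord (leqnSn N) j = lift ord_max j.
  by apply/val_inj/esym/lift_max.
by rewrite liftK.
Qed.

Lemma shift_input th e D t w (i : 'I_N) : causal th ->
  ol_input (shift_policy th e D t) w (widen_ord (leqnSn N) i) =
  ol_input th (cons_seq t w) (lift ord0 i).
Proof.
move=> cth; rewrite ol_inputE; last exact: causal_shift.
rewrite ol_inputE// -shift_sum /= /shift_offset /shift_gain.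
have -> : widen_ord (leqnSn N) i = lift ord_max i.
  by apply/val_inj/esym/lift_max.
by rewrite liftK.
Qed.

Lemma shift_input_last th e D t w : causal th ->
  ol_input (shift_policy th e D t) w ord_max =
  e + \sum_j D j *m cons_seq t w j.
Proof.
move=> cth; rewrite ol_inputE; last exact: causal_shift.
rewrite -shift_sum /= /shift_offset /shift_gain unlift_none.
by congr (_ + _); apply: eq_bigr => j _; case: unliftP.
Qed.

Lemma ol_input_ord0 (th : policy R m q N.+1) w : ol_input th w ord0 = th.2 ord0.
Proof. by rewrite /ol_input big1 ?addr0. Qed.

Lemma shift_state x th e D t w (k : nat) : causal th -> (k <= N)%N ->
  ol_state s (A *m x + B *m th.2 ord0 + G *m t) (shift_policy th e D t) w k =
  ol_state s x th (cons_seq t w) k.+1.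
Proof.
move=> cth; elim: k => [_|k IH kN].
  rewrite /ol_state /= -[0%N]/(val (@ord0 N)) !ext0E.
  by rewrite ol_input_ord0 cons_seq0.
have := IH (ltnW kN); rewrite /ol_state => IHk.
rewrite [LHS]/= IHk [in RHS]/trajectory -/trajectory.
have extL (V : nmodType) (f : 'I_N.+1 -> V) :
  ext0 f k = f (widen_ord (leqnSn N) (Ordinal kN)) by rewrite -ext0E.
have extR (V : nmodType) (f : 'I_N.+1 -> V) :
  ext0 f k.+1 = f (lift ord0 (Ordinal kN)) by rewrite -ext0E lift0.
congr (_ + _); [congr (_ + _)|]; congr (mulmx _ _); rewrite extL extR.
  exact: shift_input.
by rewrite cons_seq_lift.
Qed.

Section Terminal.
Context (Kf : 'M[R]_(m, n)).
Local Notation AK := (A + B *m Kf).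

Lemma shift_state_last x th e D t w : causal th ->
  (forall w', Kf *m ol_state s x th w' N.+1 = e + \sum_j D j *m w' j) ->
  ol_state s (A *m x + B *m th.2 ord0 + G *m t) (shift_policy th e D t) w N.+1 =
  AK *m ol_state s x th (cons_seq t w) N.+1 + G *m w ord_max.
Proof.
move=> cth eD.
have := shift_state x e D t w cth (leqnn N); rewrite {1}/ol_state => xN.
rewrite [LHS]/ol_state [trajectory _ _ _ _ _]/= xN.
rewrite -[N in ext0 (ol_input _ _) N]/(val (@ord_max N)).
rewrite -[N in ext0 w N]/(val (@ord_max N)) !ext0E.
by rewrite shift_input_last// -eD mulmxDl mulmxA.
Qed.

Hypothesis Xf_inv : forall x w, Xf x -> W w ->
  Z (x, Kf *m x) /\ Xf (AK *m x + G *m w).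

Lemma cons_seqW t w : W t -> (forall i, W (w i)) -> forall i, W (cons_seq t w i).
Proof. by move=> Wt Ww i; rewrite /cons_seq; case: cons_index. Qed.

Lemma shift_feasible x th e D t :
  (forall w', Kf *m ol_state s x th w' N.+1 = e + \sum_j D j *m w' j) ->
  feasible_policies s x th -> W t ->
  feasible_policies s (A *m x + B *m th.2 ord0 + G *m t)
    (shift_policy th e D t).
Proof.
move=> eD [cth fth] Wt; split; first exact: causal_shift.
move=> w Ww; have [Zk XfN] := fth _ (cons_seqW Wt Ww).
rewrite shift_state_last//; have [ZN XfS] := Xf_inv XfN (Ww ord_max); split=> // k.
case: (unliftP ord_max k) => [i ->|->].
  have -> : lift ord_max i = widen_ord (leqnSn N) i.
    exact/val_inj/lift_max.
  rewrite shift_input// shift_state//=; last exact: ltnW.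
  by have := Zk (lift ord0 i); rewrite lift0.
by rewrite shift_input_last// shift_state// -eD.
Qed.

(** Both runs share the stage costs of times 1 to [N]; they differ by the first
    stage cost of the old run and the last one and the terminal cost of the
    new run. *)
Lemma shift_cost x th e D t w : causal th ->
  (forall w', Kf *m ol_state s x th w' N.+1 = e + \sum_j D j *m w' j) ->
  let y := ol_state s x th (cons_seq t w) N.+1 in
  total_cost s (A *m x + B *m th.2 ord0 + G *m t) (shift_policy th e D t) w +
    stage_cost s x (th.2 ord0) + quad P y =
  total_cost s x th (cons_seq t w) + stage_cost s y (Kf *m y) +
    quad P (AK *m y + G *m w ord_max).
Proof.
move=> cth eD y; rewrite /total_cost shift_state_last// -/y.
rewrite big_ord_recr/= shift_state// shift_input_last// -eD -/y.
rewrite [in RHS]big_ord_recl/= ol_input_ord0 -/y.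
rewrite (eq_bigr (fun k : 'I_N =>
  stage_cost s (ol_state s x th (cons_seq t w) (lift ord0 k))
    (ol_input th (cons_seq t w) (lift ord0 k)))); last first.
  by move=> k _; rewrite shift_input// shift_state ?lift0// ltnW.
by rewrite {3}/ol_state/=; ring.
Qed.

End Terminal.

End Shift.

(** * Expected costs *)

Section RandomCost.
Context {R : realType} {n m q : nat} (s : mpc R n m q).
Context {d : measure_display} {T : measurableType d} (Pr : probability T R).

Lemma ess_bdd_ext0 (a b N : nat) (f : T -> 'I_N -> 'M[R]_(a, b)) (k : nat) :
  (forall i, ess_bdd_mx Pr (fun w => f w i)) ->
  ess_bdd_mx Pr (fun w => ext0 (f w) k).
Proof.
by move=> bf; rewrite /ext0; case: insubP => [i _ _|_]; [|exact: ess_bdd_mx_cst].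
Qed.

Lemma ess_bdd_trajectory (x : T -> 'cV[R]_n) (u : T -> nat -> 'cV[R]_m)
    (w : T -> nat -> 'cV[R]_q) (k : nat) :
  ess_bdd_mx Pr x -> (forall i, ess_bdd_mx Pr (fun t => u t i)) ->
  (forall i, ess_bdd_mx Pr (fun t => w t i)) ->
  ess_bdd_mx Pr (fun t => trajectory s (x t) (u t) (w t) k).
Proof.
move=> bx bu bw; elim: k => //= k IH.
by apply: ess_bdd_mxD; [apply: ess_bdd_mxD|]; apply: ess_bdd_mxMl.
Qed.

Section Cost.
Context (x : T -> 'cV[R]_n) (th : T -> policy R m q (mpcN s)).
Context (w : T -> 'I_(mpcN s) -> 'cV[R]_q).
Hypothesis bx : ess_bdd_mx Pr x.
Hypothesis bM : forall i j, ess_bdd_mx Pr (fun t => (th t).1 i j).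
Hypothesis (bv : forall i, ess_bdd_mx Pr (fun t => (th t).2 i)).
Hypothesis (bw : forall i, ess_bdd_mx Pr (fun t => w t i)).

Lemma ess_bdd_ol_input i : ess_bdd_mx Pr (fun t => ol_input (th t) (w t) i).
Proof.
apply: ess_bdd_mxD => //; apply: ess_bdd_mx_sum => j _.
exact: ess_bdd_mxM.
Qed.

Lemma ess_bdd_ol_state k : ess_bdd_mx Pr (fun t => ol_state s (x t) (th t) (w t) k).
Proof.
apply: ess_bdd_trajectory => // i; apply: ess_bdd_ext0 => // j.
exact: ess_bdd_ol_input.
Qed.

Lemma ess_bdd_stage_cost (y : T -> 'cV[R]_n) (u : T -> 'cV[R]_m) :
  ess_bdd_mx Pr y -> ess_bdd_mx Pr u ->
  ess_bdd Pr (fun t => stage_cost s (y t) (u t)).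
Proof. by move=> yb ub; apply: ess_bddD; exact: ess_bdd_quad. Qed.

Lemma ess_bdd_total_cost : ess_bdd Pr (fun t => total_cost s (x t) (th t) (w t)).
Proof.
apply: ess_bddD; last exact/ess_bdd_quad/ess_bdd_ol_state.
apply: ess_bdd_sum => k _; apply: ess_bdd_stage_cost.
  exact: ess_bdd_ol_state.
exact: ess_bdd_ol_input.
Qed.

End Cost.

Section Split.
Context (w : T -> 'I_(mpcN s) -> 'cV[R]_q).
Hypothesis cw : forall i, centered_mx Pr (fun t => w t i).

Lemma centered_ol_input (M : 'I_(mpcN s) -> 'I_(mpcN s) -> 'M[R]_(m, q)) i :
  centered_mx Pr (fun t => ol_input (M, fun=> 0) (w t) i).
Proof.
rewrite /ol_input/=; apply: centered_mxD; first exact: centered_mx0.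
by apply: centered_mx_sum => j _; exact: centered_mxMl.
Qed.

Lemma centered_ext0 (a b N : nat) (f : T -> 'I_N -> 'M[R]_(a, b)) (k : nat) :
  (forall i, centered_mx Pr (fun w => f w i)) ->
  centered_mx Pr (fun w => ext0 (f w) k).
Proof.
by move=> bf; rewrite /ext0; case: insubP => [i _ _|_]; [|exact: centered_mx0].
Qed.

Lemma centered_ol_state (M : 'I_(mpcN s) -> 'I_(mpcN s) -> 'M[R]_(m, q)) k :
  centered_mx Pr (fun t => ol_state s 0 (M, fun=> 0) (w t) k).
Proof.
rewrite /ol_state; elim: k => [|k IH] /=; first exact: centered_mx0.
apply: centered_mxD; first apply: centered_mxD; apply: centered_mxMl => //.
  by apply: centered_ext0 => i; exact: centered_ol_input.
exact: centered_ext0.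
Qed.

(** The disturbances have zero mean, so the terms of the cost that are linear
    in them vanish in expectation. *)
Lemma Rintegral_total_cost x th :
  (mpcQ s)^T = mpcQ s -> (mpcR s)^T = mpcR s -> (mpcP s)^T = mpcP s ->
  \int[Pr]_t (total_cost s x th (w t)) =
  total_cost s x th (fun=> 0) +
  \int[Pr]_t (total_cost s 0 (th.1, fun=> 0) (w t)).
Proof.
move=> QT RT PT.
have bw i : ess_bdd_mx Pr (fun t => w t i) by case: (cw i).
have bcst a b (K : 'M[R]_(a, b)) : ess_bdd_mx Pr (fun=> K) by exact: ess_bdd_mx_cst.
have bS x' th' k : ess_bdd_mx Pr (fun t => ol_state s x' th' (w t) k).
  by apply: (@ess_bdd_ol_state (fun=> x') (fun=> th')).
have bI (th' : policy R m q (mpcN s)) k :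
    ess_bdd_mx Pr (fun t => ol_input th' (w t) k).
  exact: (@ess_bdd_ol_input (fun=> th') w (fun i j => bcst _ _ (th'.1 i j))
    (fun i => bcst _ _ (th'.2 i)) bw k).
have bST x' (th' : policy R m q (mpcN s)) (k : 'I_(mpcN s)) :
    ess_bdd Pr (fun t => stage_cost s (ol_state s x' th' (w t) k)
      (ol_input th' (w t) k)).
  exact: ess_bdd_stage_cost.
rewrite /total_cost RintegralTD; last 2 first.
- by apply: ess_bdd_sum => k _; apply: bST.
- exact: ess_bdd_quad.
rewrite RintegralTD; last 2 first.
- by apply: ess_bdd_sum => k _; apply: bST.
- exact: ess_bdd_quad.
rewrite addrACA RintegralT_sum// RintegralT_sum// -big_split/=.
congr (_ + _).
  apply: eq_bigr => k _; rewrite /stage_cost !RintegralTD; try exact: ess_bdd_quad.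
  rewrite addrACA; congr (_ + _).
    under eq_Rintegral do rewrite ol_state_split.
    by rewrite Rintegral_quadD//; exact: centered_ol_state.
  under eq_Rintegral do rewrite ol_input_split.
  rewrite Rintegral_quadD//; last exact: centered_ol_input.
  by rewrite ol_input0.
under eq_Rintegral do rewrite ol_state_split.
by rewrite Rintegral_quadD//; exact: centered_ol_state.
Qed.

End Split.
End RandomCost.

Section Worst.
Context {R : realType} {n m q : nat} (s : mpc R n m q) (d : R * 'M[R]_q).
Hypothesis bW : bounded_set (mpcW s).
Local Notation seqP := (seq_ambiguity 'I_(mpcN s) (mpcW s) d).

Lemma ess_bdd_cost_path Pr x th : seqP Pr ->
  ess_bdd Pr (fun w => total_cost s x th w).
Proof.
move=> sPr; apply: (@ess_bdd_total_cost _ _ _ _ s _ _ Pr (fun=> x) (fun=> th)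
  (fun w => w)).
- exact: ess_bdd_mx_cst.
- by move=> i j; exact: ess_bdd_mx_cst.
- by move=> i; exact: ess_bdd_mx_cst.
- by move=> i; have [] := centered_coord bW sPr i.
Qed.

Lemma worst_cost_le x th (C : R) :
  (forall Pr, seqP Pr -> \int[Pr]_w (total_cost s x th w) <= C) ->
  (worst_cost s d x th <= C%:E)%E.
Proof.
move=> bC; apply: ub_ereal_sup => _ [Pr sPr <-].
rewrite unlock -EFin_Rintegral ?lee_fin; first exact: bC.
exact: ess_bdd_cost_path.
Qed.

Lemma worst_cost_ge x th Pr : seqP Pr ->
  ((\int[Pr]_w (total_cost s x th w))%:E <= worst_cost s d x th)%E.
Proof.
move=> sPr; apply: ereal_sup_ubound; exists Pr => //.
by rewrite unlock -EFin_Rintegral//; exact: ess_bdd_cost_path.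
Qed.

End Worst.

(** * Laws of shifted and restricted disturbance sequences *)

Section SeqLaws.
Context {R : realType} {q : nat} (W : set 'cV[R]_q) (d : R * 'M[R]_q).
Local Notation T := (borel 'cV[R]_q).

(** Laws are compared on measurable sets only: on other sets the set functions
    may differ. *)
Lemma eq_ambiguity (mu nu : probability T R) :
  (forall A, measurable A -> mu A = nu A) -> ambiguity W d mu -> ambiguity W d nu.
Proof.
move=> mn [[mu0 muW] mub].
have eI (f : T -> \bar R) : (\int[nu]_w f w = \int[mu]_w f w)%E.
  by apply: eq_measure_integral => A mA _; rewrite /= mn.
split; last first.
  move: mub; congr (cov_ball d _); apply/matrixP => i j; rewrite !mxE.
  by rewrite unlock eI.
split; first by move=> i; have := mu0 i; rewrite unlock eI.
by have [K [mK K0 KW]] := muW; exists K; split => //; rewrite -mn.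
Qed.

Lemma insert_law_ambiguity (I J : choiceType) (h : J -> option I) (g : I -> J)
    (mu : probability T R) (Pr : probability (path_space I T) R) :
  ocancel h g -> (forall j j', h j = None -> h j' = None -> j = j') ->
  ambiguity W d mu -> seq_ambiguity I W d Pr ->
  seq_ambiguity J W d (insert_law h mu Pr).
Proof.
move=> hK hN amu [ind aPr]; split; first exact: insert_law_indep hK hN ind.
move=> j; case hj : (h j) => [i|].
  by apply: eq_ambiguity (aPr i) => A mA; rewrite [RHS]insert_law_coord// hj.
by apply: eq_ambiguity amu => A mA; rewrite [RHS]insert_law_coord// hj.
Qed.

Lemma seq_ambiguity_restrict (N : nat) (Pr : probability (path_space nat T) R) :
  seq_ambiguity nat W d Pr -> exists Pr', seq_ambiguity 'I_N.+1 W d Pr'.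
Proof.
move=> sPr; have [_ /(_ 0%N) a0] := sPr.
exists (insert_law (fun i : 'I_N.+1 => Some (i : nat))
  (distribution Pr (@Defs.coord nat _ T 0%N)) Pr).
by apply: (@insert_law_ambiguity _ _ _ inord) => // i; rewrite /= inord_val.
Qed.

Lemma seq_ambiguity_cons (N : nat) mu (Pr : probability (path_space 'I_N.+1 T) R) :
  ambiguity W d mu -> seq_ambiguity 'I_N.+1 W d Pr ->
  seq_ambiguity 'I_N.+1 W d (insert_law (@cons_index N) mu Pr).
Proof.
move=> amu sPr.
apply: (@insert_law_ambiguity _ _ _ (fun i : 'I_N.+1 => inord i.+1)) => //.
  move=> i; rewrite /cons_index; case: unliftP => [j ->|] //=.
  by apply/val_inj; rewrite /= inordK ?ltnS// lift0.
by move=> i j; rewrite /cons_index; case: unliftP => [//|-> _]; case: unliftP.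
Qed.

End SeqLaws.

(** * Decrease of the optimal cost in expectation *)

Section Descent.
Context {R : realType} {n m q : nat}.
Context (A : 'M[R]_n) (B : 'M[R]_(n, m)) (G : 'M[R]_(n, q)).
Context (U : set 'cV[R]_m) (W : set 'cV[R]_q) (Z : set ('cV[R]_n * 'cV[R]_m)).
Context (Xf : set 'cV[R]_n) (N : nat) (Q : 'M[R]_n) (Ru : 'M[R]_m).
Context (P : 'M[R]_n) (Kf : 'M[R]_(m, n)) (d : R * 'M[R]_q).
Local Notation s := (MPC A B G U W Z Xf N.+1 Q Ru P).
Local Notation AK := (A + B *m Kf).
Local Notation T := (borel 'cV[R]_q).
Local Notation sigma := (worst_trace (G^T *m P *m G) d).
Local Notation seqP := (seq_ambiguity 'I_N.+1 W d).

Hypotheses (psdQ : psd Q) (psdR : psd Ru) (psdP : psd P).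
Hypotheses (bU : bounded_set U) (bW : bounded_set W).
Hypothesis ZU : forall x u, Z (x, u) -> U u.
Hypothesis adm : admissible W d.
Hypothesis lyap : loewner_le (AK^T *m P *m AK) (P - Q - Kf^T *m Ru *m Kf).
Hypothesis Xf_inv : forall x w, Xf x -> W w ->
  Z (x, Kf *m x) /\ Xf (AK *m x + G *m w).

(** The last disturbance of the new run lies beyond the horizon of the old
    one. *)
Lemma cons_seq_upd t (w : path_space 'I_N.+1 T) (t' : T) :
  cons_seq t (upd w ord_max t') = cons_seq t w.
Proof.
apply/funext => i; case: (unliftP ord0 i) => [j ->|->].
  rewrite !cons_seq_lift /upd.
  by case: eqP => // /(congr1 val) /= jN; have := ltn_ord j; rewrite jN ltnn.
by rewrite !cons_seq0.
Qed.

Lemma ess_bdd_cons_seq (Pr : probability (path_space 'I_N.+1 T) R) t i :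
  seqP Pr -> ess_bdd_mx Pr (fun w => cons_seq t w i).
Proof.
move=> sPr; case: (unliftP ord0 i) => [j ->|->].
  have [bj _] := centered_coord bW sPr (widen_ord (leqnSn N) j).
  by move=> a b; apply: eq_ess_bdd (bj a b) => w; rewrite cons_seq_lift.
by move=> a b; apply: eq_ess_bdd (ess_bdd_cst Pr (t a b)) => w; rewrite cons_seq0.
Qed.

Section Candidate.
Context (x : 'cV[R]_n) (th : policy R m q N.+1) (e : 'cV[R]_m).
Context (D : 'I_N.+1 -> 'M[R]_(m, q)).
Hypothesis cth : causal th.
Hypothesis eD : forall w',
  Kf *m ol_state s x th w' N.+1 = e + \sum_j D j *m w' j.
Local Notation succ t := (A *m x + B *m th.2 ord0 + G *m t).
Local Notation shift t := (shift_policy th e D t).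

(** The Lyapunov inequality for [Kf] pays for the last stage cost and the new
    terminal cost, up to the contribution of the last disturbance. *)
Lemma shift_expected_cost (Pr : probability (path_space 'I_N.+1 T) R) t :
  seqP Pr ->
  \int[Pr]_w (total_cost s (succ t) (shift t) w) + stage_cost s x (th.2 ord0) <=
  \int[Pr]_w (total_cost s x th (cons_seq t w)) + sigma.
Proof.
have arith a st p c b r k (sg : R) : a + st + p = c + b + r ->
    r <= k + sg -> b + k <= p -> a + st <= c + sg by lra.
move=> sPr.
pose y (w : path_space 'I_N.+1 T) := ol_state s x th (cons_seq t w) N.+1.
have bcs i := ess_bdd_cons_seq t i sPr.
have bc : ess_bdd Pr (fun w => total_cost s x th (cons_seq t w)).
  apply: (@ess_bdd_total_cost _ _ _ _ s _ _ Pr (fun=> x) (fun=> th)) => //.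
  - exact: ess_bdd_mx_cst.
  - by move=> i j; exact: ess_bdd_mx_cst.
  - by move=> i; exact: ess_bdd_mx_cst.
have by_ : ess_bdd_mx Pr y.
  apply: (@ess_bdd_ol_state _ _ _ _ s _ _ Pr (fun=> x) (fun=> th)) => //.
  - exact: ess_bdd_mx_cst.
  - by move=> i j; exact: ess_bdd_mx_cst.
  - by move=> i; exact: ess_bdd_mx_cst.
have bs : ess_bdd Pr (fun w => stage_cost s (y w) (Kf *m y w)).
  by apply: ess_bdd_stage_cost => //; exact: ess_bdd_mxMl.
have bA : ess_bdd_mx Pr (fun w => AK *m y w) by exact: ess_bdd_mxMl.
have bq : ess_bdd Pr (fun w => quad P (AK *m y w + G *m (w ord_max : 'cV[R]_q))).
  apply/ess_bdd_quad/ess_bdd_mxD => //; apply: ess_bdd_mxMl.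
  by have [] := centered_coord bW sPr ord_max.
have bP : ess_bdd Pr (fun w => quad P (y w)) by exact: ess_bdd_quad.
have bt : ess_bdd Pr (fun w => total_cost s (succ t) (shift t) w).
  exact: (@ess_bdd_cost_path _ _ _ _ s d).
have key : \int[Pr]_w (total_cost s (succ t) (shift t) w) +
    stage_cost s x (th.2 ord0) + \int[Pr]_w (quad P (y w)) =
  \int[Pr]_w (total_cost s x th (cons_seq t w)) +
    \int[Pr]_w (stage_cost s (y w) (Kf *m y w)) +
    \int[Pr]_w (quad P (AK *m y w + G *m (w ord_max : 'cV[R]_q))).
  rewrite -[X in _ + X + _](RintegralT_cst Pr).
  have bst := ess_bdd_cst Pr (stage_cost s x (th.2 ord0)).
  rewrite -(RintegralTD bt bst) -(RintegralTD (ess_bddD bt bst) bP).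
  rewrite -(RintegralTD bc bs) -(RintegralTD (ess_bddD bc bs) bq).
  by apply: eq_Rintegral => w _; exact: shift_cost.
have step : \int[Pr]_w (quad P (AK *m y w + G *m (w ord_max : 'cV[R]_q))) <=
    \int[Pr]_w (quad P (AK *m y w)) + sigma.
  apply: (Rintegral_path_step_le bW adm sPr) => // w t'.
  by rewrite /y cons_seq_upd.
have ly : \int[Pr]_w (stage_cost s (y w) (Kf *m y w)) +
    \int[Pr]_w (quad P (AK *m y w)) <= \int[Pr]_w (quad P (y w)).
  have bAq := ess_bdd_quad P bA.
  rewrite -(RintegralTD bs bAq); apply: (le_RintegralT (ess_bddD bs bAq) bP).
  by apply: aeW => w; exact: (lyapunov_le (y w) lyap).
exact: arith key step ly.
Qed.

Lemma integral_insert_cost (mu : probability T R)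
    (Pr : probability (path_space 'I_N.+1 T) R) :
  measurable_fun setT (fun w : path_space 'I_N.+1 T => total_cost s x th w) ->
  (\int[insert_law (@cons_index N) mu Pr]_w (total_cost s x th w)%:E =
   \int[mu]_t \int[Pr]_w (total_cost s x th (cons_seq t w))%:E)%E /\
  measurable_fun setT
    (fun t : T => \int[Pr]_w (total_cost s x th (cons_seq t w))%:E)%E.
Proof.
move=> /measurable_EFinP mc.
have c0 w : (0 <= (total_cost s x th w)%:E)%E.
  by rewrite lee_fin; exact: total_cost_ge0.
have mins := measurableT_comp mc (measurable_insert_coord (@cons_index N)).
split.
  rewrite ge0_integral_distribution//.
  exact: (@fubini_tonelli1 _ _ _ _ _ mu Pr _ mins (fun z => c0 _)).
exact: (@measurable_fun_fubini_tonelli_F _ _ _ _ _ Pr _ mins (fun z => c0 _)).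
Qed.

Lemma ess_bdd_shift_cost (mu : probability T R) : ambiguity W d mu ->
  ess_bdd mu (fun t => total_cost s (succ (t : 'cV[R]_q)) (shift t) (fun=> 0)).
Proof.
move=> [zmu _]; have [bt _] := zero_mean_entries bW zmu.
apply: (@ess_bdd_total_cost _ _ _ _ s _ _ mu (fun t : T => succ (t : 'cV[R]_q))
  (fun t : T => shift t) (fun _ _ => 0)).
- by apply: ess_bdd_mxD; [exact: ess_bdd_mx_cst|exact: ess_bdd_mxMl].
- by move=> i j; exact: ess_bdd_mx_cst.
- move=> i; rewrite /shift_policy /shift_offset/=.
  by case: unlift => [i'|]; apply: ess_bdd_mxD;
    [exact: ess_bdd_mx_cst|exact: ess_bdd_mxMl
    |exact: ess_bdd_mx_cst|exact: ess_bdd_mxMl].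
- by move=> i; exact: ess_bdd_mx_cst.
Qed.

Lemma shift_total_cost (Pr : probability (path_space 'I_N.+1 T) R) t :
  seqP Pr ->
  \int[Pr]_w (total_cost s (succ t) (shift t) w) =
  total_cost s (succ t) (shift t) (fun=> 0) +
  \int[Pr]_w (total_cost s 0 ((shift 0).1, fun=> 0) w).
Proof.
move=> sPr.
have cw i := centered_coord bW sPr i.
exact: (@Rintegral_total_cost _ _ _ _ s _ _ Pr (fun w => w) cw (succ t) (shift t)
  psdQ.1 psdR.1 psdP.1).
Qed.

(** Prepending an independent disturbance of law [mu] to a sequence of law [Pr]
    gives again an admissible law, against which [V] is an upper bound. *)
Lemma shift_expected_descent (mu : probability T R)
    (Pr : probability (path_space 'I_N.+1 T) R) (V : R) :
  ambiguity W d mu -> seqP Pr -> (worst_cost s d x th <= V%:E)%E ->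
  \int[mu]_t (total_cost s (succ (t : 'cV[R]_q)) (shift t) (fun=> 0)) +
  \int[Pr]_w (total_cost s 0 ((shift 0).1, fun=> 0) w) +
  stage_cost s x (th.2 ord0) <= V + sigma.
Proof.
move=> amu sPr wV.
have bF := ess_bdd_shift_cost amu.
have sPr' := seq_ambiguity_cons amu sPr.
have bt := @ess_bdd_cost_path _ _ _ _ s d bW _ x th sPr'.
have [intE mK] := integral_insert_cost mu Pr bt.1.
set S0 := (X in _ + X + _ <= _); set st := stage_cost _ _ _.
have Sst0 : 0 <= S0 + st.
  rewrite addr_ge0// /S0.
    by apply: Rintegral_ge0 => w _; exact: total_cost_ge0.
  by apply: addr_ge0; [exact: psdQ.2|exact: psdR.2].
have s0 : 0 <= sigma.
  exact: (worst_trace_ge0 bW adm amu (psd_congr G psdP)).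
have c0 t w : (0 <= (total_cost s x th (cons_seq t w))%:E)%E.
  by rewrite lee_fin; exact: total_cost_ge0.
have pw (t : 'cV[R]_q) :
    ((total_cost s (succ t) (shift t) (fun=> 0) + (S0 + st))%:E <=
     \int[Pr]_w (total_cost s x th (cons_seq t w))%:E + sigma%:E)%E.
  rewrite -EFin_Rintegral; last first.
    apply: (@ess_bdd_total_cost _ _ _ _ s _ _ Pr (fun=> x) (fun=> th)).
    - exact: ess_bdd_mx_cst.
    - by move=> i j; exact: ess_bdd_mx_cst.
    - by move=> i; exact: ess_bdd_mx_cst.
    - by move=> i; apply: (ess_bdd_cons_seq t i sPr).
  rewrite -EFinD lee_fin addrA /S0 -(shift_total_cost t sPr).
  exact: (shift_expected_cost t sPr).
have bS := ess_bdd_cst mu (S0 + st).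
rewrite -addrA -[X in _ + X <= _](RintegralT_cst mu) -(RintegralTD bF bS).
rewrite -lee_fin (EFin_Rintegral (ess_bddD bF bS)).
apply: (@le_trans _ _ (\int[mu]_t
    (\int[Pr]_w (total_cost s x th (cons_seq t w))%:E + sigma%:E))%E).
  apply: ge0_le_integral; first exact: measurableT.
  - by move=> t _; rewrite lee_fin; apply: addr_ge0 => //; exact: total_cost_ge0.
  - by apply/measurable_EFinP; exact: (ess_bddD bF bS).1.
  - by apply: (emeasurable_funD mK); exact: measurable_cst.
  - by move=> t _; exact: pw.
rewrite ge0_integralD//; last first.
  by move=> t _; apply: integral_ge0 => w _; exact: c0.
rewrite integral_cst//= probability_setT mule1 -intE EFinD leeD2r//.
rewrite -EFin_Rintegral//; apply: le_trans wV.
exact: (@worst_cost_ge _ _ _ _ s).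
Qed.

Lemma feasible_worst_cost : feasible_policies s x th ->
  exists2 C : R, 0 <= C & (worst_cost s d x th <= C%:E)%E.
Proof.
move=> fth; pose K := \sum_i `|x i 0|.
have [C CP] := @feasible_cost_bound _ _ _ _ s K bU bW ZU.
exists (Num.max C 0); first by rewrite le_max lexx orbT.
apply: worst_cost_le => // Pr sPr.
rewrite -[leRHS](RintegralT_cst Pr); apply: le_RintegralT.
- exact: (@ess_bdd_cost_path _ _ _ _ s d).
- exact: ess_bdd_cst.
apply: sub_ae (ae_path sPr) => w Ww; rewrite le_max; apply/orP; left.
apply: CP fth _ Ww => i; rewrite /K (bigD1 i)//= lerDl.
exact: sumr_ge0.
Qed.

End Candidate.

(** The optimal cost at the successor state is at most the cost of the shifted
    policy; the latter is the sum of a function of [t] and of a supremum that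
    does not depend on [t], so that integrating over [t] commutes with the
    supremum over the later disturbances. *)
Lemma value_descent (x : 'cV[R]_n) (th : policy R m q N.+1)
    (mu : probability T R) (Pr0 : probability (path_space 'I_N.+1 T) R) (V : R) :
  W 0 -> feasible_policies s x th -> ambiguity W d mu -> seqP Pr0 ->
  (worst_cost s d x th <= V%:E)%E ->
  exists F : 'cV[R]_q -> R,
    [/\ ess_bdd mu (F : T -> R), forall t, 0 <= F t,
       forall t, W t -> let x' := A *m x + B *m th.2 ord0 + G *m t in
         feasible_set s x' /\ (value s d x' <= (F t)%:E)%E &
       \int[mu]_t (F (t : 'cV[R]_q)) + stage_cost s x (th.2 ord0) <= V + sigma].
Proof.
move=> W0 fth amu sPr0 wV; have cth := fth.1.
have [c [D cD]] := @ol_state_affine _ _ _ _ s x th N.+1.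
pose e := Kf *m c; pose D' j := Kf *m D j.
have eD w : Kf *m ol_state s x th w N.+1 = e + \sum_j D' j *m w j.
  rewrite cD mulmxDr mulmx_sumr; congr (_ + _).
  by apply: eq_bigr => j _; rewrite mulmxA.
pose sh t := shift_policy th e D' t.
pose sx (t : 'cV[R]_q) := A *m x + B *m th.2 ord0 + G *m t.
have fsh t : W t -> feasible_policies s (sx t) (sh t).
  by move=> Wt; apply: (shift_feasible Xf_inv eD).
pose J := [set \int[Pr]_w (total_cost s 0 ((sh 0).1, fun=> 0) w) | Pr in seqP].
have J0 : J !=set0 by eexists; exists Pr0.
have Jub : has_ubound J.
  have [C C0 wC] := feasible_worst_cost (fsh 0 W0).
  exists C => _ [Pr sPr <-].
  have := le_trans (@worst_cost_ge _ _ _ _ s d bW (sx 0) (sh 0) Pr sPr) wC.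
  rewrite lee_fin (shift_total_cost x th e D' 0 sPr).
  by apply: le_trans; rewrite lerDr; exact: total_cost_ge0.
have SJ Pr : seqP Pr -> \int[Pr]_w (total_cost s 0 ((sh 0).1, fun=> 0) w) <= sup J.
  by move=> sPr; apply: ub_le_sup => //; exists Pr.
have S0 : 0 <= sup J.
  apply: le_trans (SJ _ sPr0); apply: Rintegral_ge0 => w _.
  exact: total_cost_ge0.
have bF := ess_bdd_shift_cost x th e D' amu.
exists (fun t => total_cost s (sx t) (sh t) (fun=> 0) + sup J); split.
- by apply: ess_bddD => //; exact: ess_bdd_cst.
- by move=> t; rewrite addr_ge0//; exact: total_cost_ge0.
- move=> t Wt; split; first by exists (sh t); exact: fsh.
  apply: (@le_trans _ _ (worst_cost s d (sx t) (sh t))).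
    by apply: ereal_inf_lbound; exists (sh t) => //; exact: fsh.
  apply: worst_cost_le => // Pr sPr.
  by rewrite (shift_total_cost x th e D' t sPr) lerD2l; exact: SJ.
rewrite RintegralTD//; last exact: ess_bdd_cst.
rewrite RintegralT_cst addrAC -lerBrDl; apply: ge_sup => // _ [Pr sPr <-].
rewrite lerBrDl addrAC.
exact: (shift_expected_descent cth eD amu sPr wV).
Qed.

End Descent.

(** * The terminal controller bounds the optimal cost *)

Section TerminalPolicy.
Context {R : realType} {n m q : nat}.
Context (A : 'M[R]_n) (B : 'M[R]_(n, m)) (G : 'M[R]_(n, q)).
Context (U : set 'cV[R]_m) (W : set 'cV[R]_q) (Z : set ('cV[R]_n * 'cV[R]_m)).
Context (Xf : set 'cV[R]_n) (N : nat) (Q : 'M[R]_n) (Ru : 'M[R]_m).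
Context (P : 'M[R]_n) (Kf : 'M[R]_(m, n)).
Local Notation s := (MPC A B G U W Z Xf N Q Ru P).
Local Notation AK := (A + B *m Kf).
Local Notation T := (borel 'cV[R]_q).

Hypotheses (psdP : psd P) (bW : bounded_set W).
Hypothesis lyap : loewner_le (AK^T *m P *m AK) (P - Q - Kf^T *m Ru *m Kf).
Hypothesis Xf_inv : forall x w, Xf x -> W w ->
  Z (x, Kf *m x) /\ Xf (AK *m x + G *m w).

Fixpoint terminal_gain (k : nat) (j : 'I_N) : 'M[R]_(n, q) :=
  if k is k'.+1 then AK *m terminal_gain k' j + (if j == k' :> nat then G else 0)
  else 0.

Definition terminal_state (x : 'cV[R]_n) (w : 'I_N -> 'cV[R]_q) (k : nat) :
    'cV[R]_n :=
  iter k (mulmx AK) x + \sum_j terminal_gain k j *m w j.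

(** The feedback [u = Kf x] written as a policy that is affine in the past
    disturbances. *)
Definition terminal_policy (x : 'cV[R]_n) : policy R m q N :=
  (fun i j : 'I_N => Kf *m terminal_gain i j,
   fun i : 'I_N => Kf *m iter i (mulmx AK) x).

Lemma terminal_gain0 (k : nat) (j : 'I_N) : (k <= j)%N -> terminal_gain k j = 0.
Proof.
elim: k => //= k IH kj.
by rewrite IH ?(ltnW kj)// mulmx0 add0r gtn_eqF.
Qed.

Lemma terminal_stateS x w (k : nat) (kN : (k < N)%N) :
  terminal_state x w k.+1 = AK *m terminal_state x w k + G *m w (Ordinal kN).
Proof.
rewrite /terminal_state mulmxDr -addrA; congr (_ + _).
rewrite mulmx_sumr (bigD1 (Ordinal kN))//= [in RHS](bigD1 (Ordinal kN))//=.
rewrite eqxx mulmxDl mulmxA -!addrA; congr (_ + _).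
rewrite addrC; congr (_ + _); apply: eq_bigr => j jk.
rewrite (_ : (j == k :> nat) = false) ?addr0 ?mulmxA//.
by apply: contraNF jk => /eqP jk; apply/eqP/val_inj.
Qed.

Lemma causal_terminal x : causal (terminal_policy x).
Proof. by move=> i j ij /=; rewrite terminal_gain0// mulmx0. Qed.

Lemma terminal_input x w i :
  ol_input (terminal_policy x) w i = Kf *m terminal_state x w i.
Proof.
rewrite ol_inputE; last exact: causal_terminal.
rewrite /= mulmxDr mulmx_sumr; congr (_ + _).
by apply: eq_bigr => j _; rewrite mulmxA.
Qed.

Lemma terminal_stateE x w (k : nat) : (k <= N)%N ->
  ol_state s x (terminal_policy x) w k = terminal_state x w k.
Proof.
elim: k => [_|k IH kN].
  rewrite /ol_state /terminal_state /= big1 ?addr0// => j _.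
  by rewrite mul0mx.
rewrite terminal_stateS -(IH (ltnW kN)) /ol_state/=.
have ext (V : nmodType) (f : 'I_N -> V) : ext0 f k = f (Ordinal kN).
  by rewrite -ext0E.
by rewrite !ext terminal_input -(IH (ltnW kN)) mulmxDl mulmxA.
Qed.

Lemma terminal_feasible x : Xf x -> feasible_policies s x (terminal_policy x).
Proof.
move=> Xfx; split; first exact: causal_terminal.
move=> w Ww.
have XfS k : (k <= N)%N -> Xf (terminal_state x w k).
  elim: k => [_|k IH kN].
    by rewrite /terminal_state /= big1 ?addr0// => j _; rewrite mul0mx.
  by rewrite terminal_stateS; have [] := Xf_inv (IH (ltnW kN)) (Ww (Ordinal kN)).
split; last by rewrite terminal_stateE//; exact: XfS.
move=> k; rewrite terminal_input terminal_stateE; last exact: ltnW.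
by have [] := Xf_inv (XfS k (ltnW (ltn_ord k))) (Ww k).
Qed.

Section Cost.
Context (d : R * 'M[R]_q) (adm : admissible W d).
Local Notation sigma := (worst_trace (G^T *m P *m G) d).

(** The Lyapunov inequality telescopes along the horizon, each disturbance adding
    at most [sigma]. *)
Lemma terminal_expected_cost (Pr : probability (path_space 'I_N T) R) x :
  seq_ambiguity 'I_N W d Pr ->
  \int[Pr]_w (total_cost s x (terminal_policy x) w) <= quad P x + N%:R * sigma.
Proof.
move=> sPr.
pose z k (w : path_space 'I_N T) := terminal_state x w k.
have bz k : ess_bdd_mx Pr (z k).
  apply: ess_bdd_mxD; first exact: ess_bdd_mx_cst.
  apply: ess_bdd_mx_sum => j _; apply: ess_bdd_mxMl.
  by have [] := centered_coord bW sPr j.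
have bAz k : ess_bdd_mx Pr (fun w => AK *m z k w) by exact: ess_bdd_mxMl.
have bst k : ess_bdd Pr (fun w => stage_cost s (z k w) (Kf *m z k w)).
  by apply: ess_bdd_stage_cost => //; exact: ess_bdd_mxMl.
have bsum k : ess_bdd Pr (fun w => \sum_(i < k) stage_cost s (z i w) (Kf *m z i w)).
  by apply: ess_bdd_sum.
have H k : (k <= N)%N ->
    \int[Pr]_w (\sum_(i < k) stage_cost s (z i w) (Kf *m z i w)) +
      \int[Pr]_w (quad P (z k w)) <= quad P x + k%:R * sigma.
  elim: k => [_|k IH kN].
    under eq_Rintegral do rewrite big_ord0.
    rewrite RintegralT_cst add0r mul0r addr0.
    rewrite -[leRHS](RintegralT_cst Pr) le_eqVlt; apply/orP; left; apply/eqP.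
    apply: eq_Rintegral => w _; rewrite /z /terminal_state /= big1 ?addr0//.
    by move=> j _; rewrite mul0mx.
  have arith a b c e' f g v (sg K : R) : a + b <= v + K * sg ->
      c + e' <= b -> f <= e' + sg -> g = a + c -> g + f <= v + (K + 1) * sg.
    by lra.
  have h1 : \int[Pr]_w (stage_cost s (z k w) (Kf *m z k w)) +
      \int[Pr]_w (quad P (AK *m z k w)) <= \int[Pr]_w (quad P (z k w)).
    rewrite -(RintegralTD (bst k) (ess_bdd_quad P (bAz k))).
    apply: (le_RintegralT (ess_bddD (bst k) (ess_bdd_quad P (bAz k)))
      (ess_bdd_quad P (bz k))).
    by apply: aeW => w; exact: (lyapunov_le (z k w) lyap).
  have h2 : \int[Pr]_w (quad P (z k.+1 w)) <=
      \int[Pr]_w (quad P (AK *m z k w)) + sigma.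
    under eq_Rintegral do rewrite /z terminal_stateS.
    apply: (Rintegral_path_step_le bW adm sPr G psdP (bAz k)) => w t /=.
    rewrite /z /terminal_state; congr (mulmx _ _); congr (_ + _).
    apply: eq_bigr => j _; rewrite /upd; case: eqP => // ->.
    by rewrite terminal_gain0// !mul0mx.
  have h3 : \int[Pr]_w (\sum_(i < k.+1) stage_cost s (z i w) (Kf *m z i w)) =
      \int[Pr]_w (\sum_(i < k) stage_cost s (z i w) (Kf *m z i w)) +
      \int[Pr]_w (stage_cost s (z k w) (Kf *m z k w)).
    rewrite -(RintegralTD (bsum k) (bst k)).
    by apply: eq_Rintegral => w _; rewrite big_ord_recr.
  by rewrite -natr1; exact: arith (IH (ltnW kN)) h1 h2 h3.
apply: le_trans (H N (leqnn N)).
rewrite -(RintegralTD (bsum N) (ess_bdd_quad P (bz N))) le_eqVlt; apply/orP; left.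
apply/eqP; apply: eq_Rintegral => w _; rewrite /total_cost terminal_stateE//.
congr (_ + _); apply: eq_bigr => k _.
by rewrite terminal_stateE ?terminal_input// ltnW.
Qed.

End Cost.

(** Near the origin the terminal policy costs at most [V_f] plus [N sigma]; away
    from it all costs are bounded, hence at most a multiple of [|x|^2]. *)
Lemma value_upper : bounded_set U -> (forall x u, Z (x, u) -> U u) ->
  interior Xf 0 -> bounded_set (feasible_set s) \/ Xf = [set: 'cV[R]_n] ->
  exists2 c : R, 0 <= c &
    forall d mu x, admissible W d -> ambiguity W d mu -> feasible_set s x ->
      (value s d x <=
       (c * sqnorm x + N%:R * worst_trace (G^T *m P *m G) d)%:E)%E.
Proof.
move=> bU ZU /interior_entries[r r0 rXf] bX.
pose cP := \sum_i \sum_j `|P i j|.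
have cP0 : 0 <= cP by apply: sumr_ge0 => i _; apply: sumr_ge0.
have [C C0 XC] : exists2 C : R, 0 <= C & forall x, feasible_set s x -> ~ Xf x ->
    forall th, feasible_policies s x th ->
    forall w, (forall i, W (w i)) -> total_cost s x th w <= C.
  case: bX => [bX|XfT]; last by exists 0 => // x _ []; rewrite XfT.
  have [K XK] := bounded_set_entries bX.
  have [C CP] := @feasible_cost_bound _ _ _ _ s K bU bW ZU.
  exists (Num.max C 0); first by rewrite le_max lexx orbT.
  move=> x Xx _ th fth w Ww; rewrite le_max; apply/orP; left.
  by apply: CP fth _ Ww; exact: XK.
exists (cP + C / r ^+ 2); first by rewrite addr_ge0// divr_ge0// sqr_ge0.
move=> d mu x adm amu Xx.
have Cr0 : 0 <= C / r ^+ 2 by rewrite divr_ge0// sqr_ge0.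
have s0 : 0 <= worst_trace (G^T *m P *m G) d.
  exact: (worst_trace_ge0 bW adm amu (psd_congr G psdP)).
have x0 := sqnorm_ge0 x.
case: (pselect (Xf x)) => Xfx.
  apply: (@le_trans _ _ (worst_cost s d x (terminal_policy x))).
    apply: ereal_inf_lbound; exists (terminal_policy x) => //.
    exact: terminal_feasible.
  apply: worst_cost_le => // Pr sPr.
  apply: le_trans (terminal_expected_cost adm x sPr) _; rewrite lerD2r.
  apply: le_trans (quad_le_sqnorm P x) _.
  by apply: ler_wpM2r => //; rewrite lerDl.
have [th fth] := Xx.
apply: (@le_trans _ _ (worst_cost s d x th)).
  by apply: ereal_inf_lbound; exists th.
apply: worst_cost_le => // Pr sPr.
apply: (@le_trans _ _ C).
  rewrite -[leRHS](RintegralT_cst Pr); apply: le_RintegralT.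
  - exact: (@ess_bdd_cost_path _ _ _ _ s d).
  - exact: ess_bdd_cst.
  by apply: sub_ae (ae_path sPr) => w Ww; exact: XC.
have [i ri] : exists i, r <= `|x i 0|.
  apply: contrapT => /forallNP nr; apply: Xfx; apply: rXf => i.
  by rewrite ltNge; apply/negP; exact: nr.
have rx : r ^+ 2 <= sqnorm x.
  apply: le_trans (sqr_le_sqnorm x i).
  by rewrite -[leRHS]real_normK ?num_real// ler_sqr ?nnegrE// ltW.
have := ler_wpM2l Cr0 rx; rewrite divfK ?expf_neq0 ?gt_eqF// mulrDl => Cx.
apply: (le_trans Cx); rewrite -addrA addrCA lerDl addr_ge0 ?mulr_ge0//.
Qed.

End TerminalPolicy.

(** * The closed loop *)

Lemma contraction_arith {R : realType} (I S X r v sg k : R) :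
  I + S <= v + sg -> X <= S -> r * v <= X + r * (k * sg) ->
  I <= (1 - r) * v + (1 + k * (1 - (1 - r))) * sg.
Proof. by lra. Qed.

Section ClosedLoop.
Context {R : realType} {n m q : nat}.
Context (A : 'M[R]_n) (B : 'M[R]_(n, m)) (G : 'M[R]_(n, q)).
Context (U : set 'cV[R]_m) (W : set 'cV[R]_q) (Z : set ('cV[R]_n * 'cV[R]_m)).
Context (Xf : set 'cV[R]_n) (N : nat) (Q : 'M[R]_n) (Ru : 'M[R]_m).
Context (P : 'M[R]_n) (Kf : 'M[R]_(m, n)) (d : R * 'M[R]_q).
Context (kap : 'cV[R]_n -> 'cV[R]_m) (c1 c2 : R).
Local Notation s := (MPC A B G U W Z Xf N.+1 Q Ru P).
Local Notation AK := (A + B *m Kf).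
Local Notation T := (borel 'cV[R]_q).
Local Notation sigma := (worst_trace (G^T *m P *m G) d).
Local Notation V x := (fine (value s d x)).

Hypotheses (psdQ : psd Q) (psdR : psd Ru) (psdP : psd P).
Hypotheses (bU : bounded_set U) (bW : bounded_set W) (W0 : W 0).
Hypothesis ZU : forall x u, Z (x, u) -> U u.
Hypothesis adm : admissible W d.
Hypothesis lyap : loewner_le (AK^T *m P *m AK) (P - Q - Kf^T *m Ru *m Kf).
Hypothesis Xf_inv : forall x w, Xf x -> W w ->
  Z (x, Kf *m x) /\ Xf (AK *m x + G *m w).
Hypothesis kap_opt : forall x, feasible_set s x ->
  exists2 th, optimal_policies s d x th & kap x = ext0 th.2 0.
Hypotheses (c1_gt0 : 0 < c1) (c1_lt : c1 < c2).
Hypothesis Q_lower : forall x, c1 * sqnorm x <= quad Q x.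
Hypothesis V_upper : forall x, feasible_set s x ->
  (value s d x <= (c2 * sqnorm x + N.+1%:R * sigma)%:E)%E.
Context (Pr : probability (path_space nat T) R).
Hypothesis sPr : seq_ambiguity nat W d Pr.

(** The optimal cost is at most [c2 |x|^2] up to a constant and the stage cost at
    least [c1 |x|^2], so a fraction [c1 / c2] of the cost is spent at each step;
    [drift] collects the constants. *)
Definition rate : R := 1 - c1 / c2.
Definition drift : R := (1 + N.+1%:R * (1 - rate)) * sigma.

Lemma c2_gt0 : 0 < c2. Proof. exact: lt_trans c1_lt. Qed.

Lemma rate_bounds : 0 < rate < 1.
Proof.
have c20 := c2_gt0; rewrite /rate subr_gt0 ltr_pdivrMr// mul1r c1_lt/=.
by rewrite gtrBl divr_gt0.
Qed.

Lemma optimal_policyP x : feasible_set s x -> exists th,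
  [/\ feasible_policies s x th, kap x = th.2 ord0,
      worst_cost s d x th = (V x)%:E & value s d x = (V x)%:E].
Proof.
move=> Xx; have [th [fth wth] kth] := kap_opt Xx.
have [C C0 wC] := feasible_worst_cost d bU bW ZU fth.
have [Pr' sPr'] := seq_ambiguity_restrict N sPr.
have w0 : (0 <= worst_cost s d x th)%E.
  apply: le_trans (@worst_cost_ge _ _ _ _ s d bW x th Pr' sPr').
  by rewrite lee_fin; apply: Rintegral_ge0 => w _; exact: total_cost_ge0.
have vfin : value s d x = (V x)%:E.
  rewrite fineK// -wth ge0_fin_numE//; exact: le_lt_trans wC (ltry _).
exists th; split; [exact: fth| |by rewrite wth|exact: vfin].
by rewrite kth -(ext0E th.2 ord0).
Qed.

Lemma stage_le_value x : feasible_set s x -> stage_cost s x (kap x) <= V x.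
Proof.
move=> Xx; have [th [fth -> wth _]] := optimal_policyP Xx.
have [Pr' sPr'] := seq_ambiguity_restrict N sPr.
rewrite -lee_fin -wth.
apply: le_trans (@worst_cost_ge _ _ _ _ s d bW x th Pr' sPr').
rewrite lee_fin -[leLHS](RintegralT_cst Pr'); apply: le_RintegralT.
- exact: ess_bdd_cst.
- exact: (@ess_bdd_cost_path _ _ _ _ s d bW).
apply: aeW => w; rewrite /total_cost big_ord_recl/= ol_input_ord0 -addrA lerDl.
apply: addr_ge0; last exact: psdP.2.
by apply: sumr_ge0 => k _; apply: addr_ge0; [exact: psdQ.2|exact: psdR.2].
Qed.

(** The decrease of the optimal cost, once the stage cost is bounded below by a
    fraction of the optimal cost. *)
Lemma closed_loop_step x (mu : probability T R) :
  feasible_set s x -> ambiguity W d mu ->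
  exists F : 'cV[R]_q -> R,
    [/\ ess_bdd mu (F : T -> R), forall t, 0 <= F t,
       forall t, W t -> let x' := A *m x + B *m kap x + G *m t in
         feasible_set s x' /\ (value s d x' <= (F t)%:E)%E &
       \int[mu]_t (F (t : 'cV[R]_q)) <= rate * V x + drift].
Proof.
move=> Xx amu; have [th [fth kth wth vE]] := optimal_policyP Xx.
have [Pr' sPr'] := seq_ambiguity_restrict N sPr.
have wV : (worst_cost s d x th <= (V x)%:E)%E by rewrite wth.
have [F [bF F0 FW FV]] := value_descent psdQ psdR psdP bU bW ZU adm lyap Xf_inv
  W0 fth amu sPr' wV.
exists F; split; [exact: bF|exact: F0|by rewrite kth; exact: FW|].
have Vx : V x <= c2 * sqnorm x + N.+1%:R * sigma.
  by rewrite -lee_fin -vE; exact: V_upper.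
have Sx : c1 * sqnorm x <= stage_cost s x (th.2 ord0).
  by apply: (le_trans (Q_lower x)); rewrite lerDl; exact: psdR.2.
have c20 := c2_gt0.
have h : c1 / c2 * V x <= c1 * sqnorm x + c1 / c2 * (N.+1%:R * sigma).
  have r0 : 0 <= c1 / c2 by rewrite divr_ge0// ltW.
  have := ler_wpM2l r0 Vx.
  by rewrite mulrDr [c1 / c2 * (c2 * _)]mulrA (divfK (lt0r_neq0 c20)).
rewrite /drift /rate.
exact: contraction_arith FV Sx h.
Qed.

Lemma cl_state_feasible x w : feasible_set s x -> (forall i, W (w i)) ->
  forall k, feasible_set s (cl_state s kap x w k).
Proof.
move=> Xx Ww; elim=> //= k IH.
have [_ /(_ 0%N) amu] := sPr.
have [F [_ _ FW _]] := closed_loop_step IH amu.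
by have [] := FW _ (Ww k).
Qed.

Lemma cl_state_upd x (w : path_space nat T) k t :
  cl_state s kap x (upd w k t) k = cl_state s kap x w k.
Proof.
suff H j : (j <= k)%N -> cl_state s kap x (upd w k t) j = cl_state s kap x w j.
  exact: H.
elim: j => //= j IH jk; rewrite IH; last exact: ltnW.
by rewrite /upd ltn_eqF.
Qed.

(** The integral of a nonnegative function is the supremum of the integrals of
    its simple minorants, so the induction is on arbitrary measurable minorants
    [phi] of the optimal cost at time [k]. Resampling the disturbance of time [k]
    turns a minorant at time [k + 1] into one at time [k]; the affine transform
    with coefficients [a] and [b] absorbs the contraction. *)
Lemma closed_loop_lower_integral x k (phi : path_space nat T -> \bar R) (a b : R) :
  feasible_set s x -> 0 <= a -> 0 <= b ->
  measurable_fun setT phi -> (forall w, 0 <= phi w)%E ->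
  (forall w : path_space nat T, (forall i, W (w i)) ->
     phi w <= (a * V (cl_state s kap x w k) + b)%:E)%E ->
  (\int[Pr]_w phi w <= (a * (rate ^+ k * V x + drift / (1 - rate)) + b)%:E)%E.
Proof.
move=> Xx; have /andP[r0 r1] := rate_bounds.
have V0 y : feasible_set s y -> 0 <= V y.
  move=> Xy; apply: le_trans (stage_le_value Xy).
  by apply: addr_ge0; [exact: psdQ.2|exact: psdR.2].
have [ind amb] := sPr.
have s0 : 0 <= sigma.
  exact: (worst_trace_ge0 bW adm (amb 0%N) (psd_congr G psdP)).
have D0 : 0 <= drift.
  by rewrite mulr_ge0// addr_ge0// mulr_ge0// subr_ge0 ltW.
elim: k phi a b => [|k IH] phi a b a0 b0 mphi phi0 phiV.
  apply: (@le_trans _ _ (\int[Pr]_w (a * V x + b)%:E)%E).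
    apply: ae_ge0_le_integral => //.
    - by move=> w _; rewrite lee_fin addr_ge0// mulr_ge0// V0.
    - by apply: sub_ae (ae_path sPr) => w Ww _; exact: phiV.
  rewrite integral_cst//= probability_setT mule1 lee_fin expr0 mul1r.
  by rewrite lerD2r ler_wpM2l// lerDl divr_ge0// subr_ge0 ltW.
rewrite (@integral_resample _ _ _ _ Pr k)//.
apply: (@le_trans _ _ ((a * rate) * (rate ^+ k * V x + drift / (1 - rate)) +
    (a * drift + b))%:E).
  apply: IH.
  - by rewrite mulr_ge0// ltW.
  - by rewrite addr_ge0// mulr_ge0.
  - exact: measurable_resample.
  - by move=> w; exact: integral_ge0.
  move=> w Ww; have Xk := cl_state_feasible Xx Ww k.
  have [F [bF F0 FW FV]] := closed_loop_step Xk (amb k).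
  have mupd : measurable_fun setT (fun t : T => upd w k t).
    apply: measurable_to_path => j; rewrite /upd.
    by case: eqP => _; [exact: measurable_id|exact: measurable_cst].
  have bG := ess_bddD (ess_bddZ a bF) (ess_bdd_cst _ b).
  apply: (@le_trans _ _ (\int[distribution Pr (@Defs.coord nat _ T k)]_t
      (a * F (t : 'cV[R]_q) + b)%:E)%E).
    apply: ae_ge0_le_integral => //.
    - exact: measurableT_comp mphi mupd.
    - by move=> t _; rewrite lee_fin addr_ge0// mulr_ge0.
    - by apply/measurable_EFinP; exact: bG.1.
    have [[_ aeW_] _] := amb k.
    apply: sub_ae aeW_ => t Wt _; apply: le_trans (phiV _ _) _.
      by move=> i; rewrite /upd; case: eqP.
    rewrite lee_fin lerD2r ler_wpM2l// -lee_fin /= cl_state_upd.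
    have [X' VF] := FW t Wt.
    have -> : upd w k t k = t by rewrite /upd eqxx.
    by have [th [_ _ _ <-]] := optimal_policyP X'.
  rewrite -(EFin_Rintegral bG) lee_fin RintegralTD; last 2 first.
  - exact: ess_bddZ.
  - exact: ess_bdd_cst.
  rewrite RintegralTZ// RintegralT_cst addrA lerD2r -mulrA -mulrDr.
  exact: ler_wpM2l.
rewrite lee_fin le_eqVlt; apply/orP; left; apply/eqP.
rewrite exprS; field.
by rewrite gt_eqF// subr_gt0.
Qed.

Import HBNNSimple.

Lemma closed_loop_stage_cost x k : feasible_set s x ->
  (expected_stage_cost s kap x k Pr <=
   (rate ^+ k * V x + drift / (1 - rate))%:E)%E.
Proof.
move=> Xx; rewrite /expected_stage_cost integral_mkcond.
set f := (X in (\int[_]_w X w)%E).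
have f0 w : (0 <= f w)%E.
  rewrite /f /patch; case: ifP => // _; rewrite lee_fin.
  by apply: addr_ge0; [exact: psdQ.2|exact: psdR.2].
rewrite ge0_integralTE//; apply: ub_ereal_sup => _ [h /= hf <-].
have mh : measurable_fun setT (fun w => (h w)%:E) by exact/measurable_EFinP.
have h0 w : (0 <= (h w)%:E)%E by rewrite lee_fin.
have hV (w : path_space nat T) : (forall i, W (w i)) ->
    ((h w)%:E <= (1 * V (cl_state s kap x w k) + 0)%:E)%E.
  move=> Ww; apply: le_trans (hf w) _.
  rewrite /f /patch ifT; last by rewrite inE.
  by rewrite lee_fin mul1r addr0; exact/stage_le_value/cl_state_feasible.
have := closed_loop_lower_integral Xx ler01 (lexx 0) mh h0 hV.
by rewrite mul1r addr0 -integralT_nnsfun.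
Qed.

End ClosedLoop.

Theorem theorem3p2 (R : realType) (n m q : nat)
  (A : 'M[R]_n) (B : 'M[R]_(n, m)) (G : 'M[R]_(n, q))
  (U : set 'cV[R]_m) (W : set 'cV[R]_q) (Z : set ('cV[R]_n * 'cV[R]_m))
  (Xf : set 'cV[R]_n) (N : nat) (Q : 'M[R]_n) (Ru : 'M[R]_m) (P : 'M[R]_n)
  (kappa : R * 'M[R]_q -> 'cV[R]_n -> 'cV[R]_m) :
  let s := MPC A B G U W Z Xf N Q Ru P in
  (0 < N)%N ->
  (forall x u, Z (x, u) -> U u) ->
  (forall d, admissible W d -> control_law s d (kappa d)) ->
  [/\ closed U, convex_set U, U 0 & bounded_set U] ->
  [/\ closed W, convex_set W, interior W 0 & bounded_set W] ->
  [/\ closed Z, convex_set Z & Z (0, 0)] ->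
  [/\ closed Xf, convex_set Xf & Xf 0] ->
  [/\ psd Q, psd Ru & psd P] ->
  (exists Kf : 'M[R]_(m, n),
    [/\ loewner_le ((A + B *m Kf)^T *m P *m (A + B *m Kf))
                   (P - Q - Kf^T *m Ru *m Kf),
        interior Xf 0 &
        forall x w, Xf x -> W w ->
          Z (x, Kf *m x) /\ Xf ((A + B *m Kf) *m x + G *m w)]) ->
  posdef Q ->
  bounded_set (feasible_set s) \/ Xf = [set: 'cV[R]_n] ->
  exists lambda c gamma : R,
    [/\ 0 < lambda < 1, 0 < c, 0 < gamma &
        forall (k : nat) (x : 'cV[R]_n) (d : R * 'M[R]_q)
               (Pr : probability (path_space nat (borel 'cV[R]_q)) R),
          feasible_set s x -> admissible W d -> seq_ambiguity nat W d Pr ->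
          (expected_stage_cost s (kappa d) x k Pr <=
           (lambda ^+ k * c * sqnorm x +
            gamma * sup [set \tr (G^T *m P *m G *m S) | S in cov_ball d])%:E)%E].
Proof.
case: N => [//|N] s _ ZU law [_ _ _ bU] [_ _ /interior_subset W0 bW] _ _.
move=> [psdQ psdR psdP] [Kf [lyap Xf0 Xf_inv]] pQ bX.
have [c1 c1_gt0 Q_lower] := posdef_coercive pQ.
have [c c_ge0 V_upper] := value_upper psdP bW lyap Xf_inv bU ZU Xf0 bX.
(* Any [c2 >= c] will do; the second term makes [c1 / c2 < 1]. *)
pose c2 := c + 2 * c1.
have c1_lt : c1 < c2 by rewrite /c2; lra.
have c2_gt0 : 0 < c2 := lt_trans c1_gt0 c1_lt.
pose r := rate c1 c2; have /andP[r0 r1] : 0 < r < 1 := rate_bounds c1_gt0 c1_lt.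
pose g := N.+1%:R + (1 + N.+1%:R * (1 - r)) / (1 - r).
exists r, c2, g; split => //; first by rewrite r0.
  rewrite /g addr_gt0// divr_gt0 ?subr_gt0//.
  by rewrite addr_gt0// mulr_gt0// subr_gt0.
move=> k x d Pr Xx adm sPr; have [_ /(_ 0%N) amu] := sPr.
have s0 : 0 <= worst_trace (G^T *m P *m G) d.
  exact: (worst_trace_ge0 bW adm amu (psd_congr G psdP)).
have V_upper2 y : feasible_set s y -> (value s d y <=
    (c2 * sqnorm y + N.+1%:R * worst_trace (G^T *m P *m G) d)%:E)%E.
  move=> Xy; apply: le_trans (V_upper d _ y adm amu Xy) _.
  by rewrite lee_fin lerD2r ler_wpM2r ?sqnorm_ge0// /c2; lra.
have [_ kap_opt _] := law d adm.
have Vx : fine (value s d x) <= c2 * sqnorm x +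
    N.+1%:R * worst_trace (G^T *m P *m G) d.
  have [th [_ _ _ vE]] := optimal_policyP psdQ psdR psdP bU bW ZU kap_opt sPr Xx.
  by rewrite -lee_fin -vE; exact: V_upper2.
apply: le_trans (closed_loop_stage_cost psdQ psdR psdP bU bW W0 ZU adm lyap
  Xf_inv kap_opt c1_gt0 c1_lt Q_lower V_upper2 sPr k Xx) _.
rewrite lee_fin -/r /drift -/r -/(worst_trace (G^T *m P *m G) d) /g.
have rk0 : 0 <= r ^+ k by rewrite exprn_ge0// ltW.
have rk1 : r ^+ k <= 1 by rewrite exprn_ile1// ltW.
rewrite [X in _ <= _ + X]mulrDl addrA mulrAC lerD2r.
apply: le_trans (ler_wpM2l rk0 Vx) _.
rewrite mulrDr mulrA lerD2l; apply: ler_piMl => //.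
exact: mulr_ge0.
Qed.
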